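(* Fix a countable directed set $(\mathbb D,\preceq)$. Let $\mathscr M$ be any (saturated) Banach integration framework. Let $\varphi_\bullet=(\varphi_j:j\in\mathbb D)$ be a bounded $\mathbb D$-net in $(\mathscr L^\infty_{\Omega,\mathfrak B})^{\mathscr M}$. For every $x\in\Omega^{\mathscr M}$ and $\mu\in\mathfrak M_\Omega^{\mathscr M}$, let $\varphi_\bullet(x)$ denote the net $(\varphi_j(x):j\in\mathbb D)$ and $\langle\!\langle\varphi_\bullet,\mu\rangle\!\rangle$ the net $(\langle\!\langle\varphi_j,\mu\rangle\!\rangle:j\in\mathbb D)$ in $\mathfrak B^{\mathscr M}$. Then, for every $\mu\in\mathfrak M_\Omega^{\mathscr M}$, $$\mathrm{osc}\bigl(\langle\!\langle\varphi_\bullet,\mu\rangle\!\rangle\bigr)\le\|\mu\|\,\sup_{x\in\Omega^{\mathscr M}}\mathrm{osc}(\varphi_\bullet(x)).$$ In particular, if the net $\varphi_\bullet(x)$ is convergent for all $x\in\Omega^{\mathscr M}$, then $\langle\!\langle\varphi_\bullet,\mu\rangle\!\rangle$ is convergent.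
   Context: Nets. A directed set is a nonempty set with a nonstrict partial order in which any two elements have an upper bound. For a $\mathbb D$-net $a_\bullet$ in a metric space with metric $\mathrm d$, $\mathrm{spr}_{\succeq i}(a_\bullet)=\sup_{j,k\succeq i}\mathrm d(a_j,a_k)$ and $\mathrm{osc}(a_\bullet)=\inf_{i\in\mathbb D}\mathrm{spr}_{\succeq i}(a_\bullet)$; the net converges if $\mathrm{osc}(a_\bullet)=0$. Henson structures and logic. A Henson metric structure is a many-sorted structure whose sorts are metric spaces with a distinguished anchor point (one sort being $\mathbb R$), with distinguished constants and distinguished functions between finite products of sorts that are bounded and uniformly continuous on bounded sets; the metrics are among the functions. Positive bounded formulas are built from atomic formulas $t\le r$, $t\ge r$ ($t$ a real-valued term, $r\in\mathbb Q$) by $\wedge,\vee$ and bounded quantifiers $\exists_r x$ (over the closed ball of radius $r$ about the anchor) and $\forall_r x$ (over the open ball of radius $r$). An approximation of $\varphi$ is obtained by strictly relaxing all bounds ($t\le r$ to $t\le r'$ with $r'>r$; $t\ge r$ to $t\ge r'$ with $r'<r$; $\exists_r$ to $\exists_{r'}$ with $r'>r$; $\forall_r$ to $\forall_{r'}$ with $r'<r$). $\mathscr M$ approximately satisfies $\varphi$ if it satisfies every approximation of $\varphi$. The theory of a class of structures is the set of positive bounded sentences approximately satisfied by all its members; a model of a theory is a structure approximately satisfying all its sentences. $\mathscr M$ is saturated if every set of positive bounded formulas, with parameters from a countable subset of $\mathscr M$, in finitely many variables confined to bounded balls, such that approximations of finitely many of its members can always be simultaneously satisfied in $\mathscr M$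 within those balls, is realized in $\mathscr M$. Classical real pre-integration frameworks. Sorts: $\mathbb R$; a nonempty set $\Omega$ (discrete metric); a $\sigma$-algebra $\mathcal A_\Omega$ of subsets of $\Omega$ containing all singletons (discrete metric); the space $\mathscr L^\infty_{\Omega,\mathbb R}$ of all bounded everywhere-defined $\mathcal A_\Omega$-measurable functions $\Omega\to\mathbb R$ with norm $\|f\|=\sup_{x\in\Omega}|f(x)|$; the Banach space $\mathfrak M_\Omega$ of all finite signed measures on $(\Omega,\mathcal A_\Omega)$ with norm $\|\mu\|=\sup\{|\mu(A)|+|\mu(A^\complement)|:A\in\mathcal A_\Omega\}$. Constants: rationals; zeros of $\mathscr L^\infty_{\Omega,\mathbb R}$ and $\mathfrak M_\Omega$; an anchor point $\omega_0\in\Omega$; $\emptyset,\Omega\in\mathcal A_\Omega$. Functions: addition, multiplication, absolute value, $\min$, $\max$ on $\mathbb R$; the $\{0,1\}$-valued characteristic function of membership on $\Omega\times\mathcal A_\Omega$; vector operations, norm, pointwise $\min$, $\max$ and absolute value on $\mathscr L^\infty_{\Omega,\mathbb R}$; evaluation $(f,x)\mapsto f(x)$; union, intersection, complement on $\mathcal A_\Omega$; $S\mapsto\chi_S$ from $\mathcal A_\Omega$ to $\mathscr L^\infty_{\Omega,\mathbb R}$; vector operations and norm on $\mathfrak M_\Omega$; $x\mapsto\{x\}$ from $\Omega$ to $\mathcal A_\Omega$ and $x\mapsto\delta_x$ from $\Omega$ to $\mathfrak M_\Omega$; evaluation $(\mu,A)\mapsto\mu(A)$; total variation $\mu\mapsto|\mu|$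 on $\mathfrak M_\Omega$, where $|\mu|(A)=\sup\{|\mu(A\cap B)|+|\mu(A\cap B^\complement)|:B\in\mathcal A_\Omega\}$; integration $\langle f,\mu\rangle=\int_\Omega f\,d\mu$ from $\mathscr L^\infty_{\Omega,\mathbb R}\times\mathfrak M_\Omega$ to $\mathbb R$. A real pre-integration framework is any model of the Henson theory of all classical real pre-integration frameworks. Banach integration frameworks. Consider the expansions of real pre-integration frameworks by two new sorts $\mathfrak B$ and $\mathscr L^\infty_{\Omega,\mathfrak B}$ and new functions and constants as follows: vector operations, norm and zero making each of $\mathfrak B$, $\mathscr L^\infty_{\Omega,\mathfrak B}$ a real Banach space; an evaluation $\mathscr L^\infty_{\Omega,\mathfrak B}\times\Omega\to\mathfrak B$, $(F,x)\mapsto F(x)$, with $\|F\|=\sup_{x\in\Omega}\|F(x)\|$ (so elements of $\mathscr L^\infty_{\Omega,\mathfrak B}$ are identified with functions $\Omega\to\mathfrak B$); a multiplication $\mathscr L^\infty_{\Omega,\mathbb R}\times\mathscr L^\infty_{\Omega,\mathfrak B}\to\mathscr L^\infty_{\Omega,\mathfrak B}$ with $(fF)(x)=f(x)F(x)$, making $\mathscr L^\infty_{\Omega,\mathfrak B}$ an $\mathscr L^\infty_{\Omega,\mathbb R}$-module; the inclusion $\mathfrak B\to\mathscr L^\infty_{\Omega,\mathfrak B}$ of $T\in\mathfrak B$ as the constant function $x\mapsto T$; a pointwise norm $|\cdot|:\mathscr L^\infty_{\Omega,\mathfrak B}\to\mathscr L^\infty_{\Omega,\mathbb R}$ with $|F|(x)=\|F(x)\|$;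 and a Banach integration, i.e. a bilinear pairing $\langle\!\langle\cdot,\cdot\rangle\!\rangle:\mathscr L^\infty_{\Omega,\mathfrak B}\times\mathfrak M_\Omega\to\mathfrak B$ such that $\langle\!\langle fT,\mu\rangle\!\rangle=\langle f,\mu\rangle T$ for $T\in\mathfrak B$ (regarded as a constant function), $f\in\mathscr L^\infty_{\Omega,\mathbb R}$, and $\|\langle\!\langle F,\mu\rangle\!\rangle\|\le|\langle|F|,|\mu|\rangle|$ for all $F\in\mathscr L^\infty_{\Omega,\mathfrak B}$. A Banach pre-integration framework is a model of the Henson theory of all such expansions, or more generally a structure in a larger language whose reduct to this language is such a model. A Banach integration framework is a saturated Banach pre-integration framework. A superscript $\mathscr M$ denotes the interpretation of a sort in $\mathscr M$. *)

(* Defs.v *)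
From HB Require Import structures.
From mathcomp Require Import all_boot all_order all_algebra.
From mathcomp Require Import all_classical all_reals all_analysis.

Set Implicit Arguments.
Unset Strict Implicit.
Unset Printing Implicit Defensive.

Import Order.TTheory GRing.Theory Num.Theory.
Import numFieldNormedType.Exports.

Local Open Scope classical_set_scope.
Local Open Scope ring_scope.

Record directed (D : Type) (le : D -> D -> Prop) : Prop := {
  directed_inhabited : inhabited D;
  directed_refl : forall i, le i i;
  directed_trans : forall i j k, le i j -> le j k -> le i k;
  directed_antisym : forall i j, le i j -> le j i -> i = j;
  directed_ub : forall i j, exists2 k, le i k & le j k
}.

Section Nets.
Variables (R : realType) (D : Type) (le : D -> D -> Prop) (T : metricType R).
Implicit Type a : D -> T.

Definition spread a (i : D) : \bar R :=
  ereal_sup [set (mdist (a p.1) (a p.2))%:E | p in [set p : D * D | le i p.1 /\ le i p.2]].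

Definition osc a : \bar R := ereal_inf (range (spread a)).

Definition convergent_net a : Prop := osc a = 0%E.

Definition bounded_net (x0 : T) a : Prop := exists C : R, forall j, mdist x0 (a j) <= C.

End Nets.

(* The sorts of a language are the elements of [base] together with the sort
   of the reals, so that [None : option base] is the real sort. A symbol takes
   a finite family of arguments, and constants are the symbols without
   arguments. A function into a finite product of sorts is given by its
   components. The metrics belong to every language, see [Dist] below. *)
Record signature := Signature {
  base : Type;
  sym : Type;
  arg : sym -> finType;
  dom : forall f : sym, arg f -> option base;
  cod : sym -> option base
}.

Definition sort (L : signature) : Type := option (base L).

Section Structures.
Variable R : realType.

Record pmetric := PMetric { pm_type :> metricType R; anchor : pm_type }.

Definition real_pmetric : pmetric := @PMetric R^o 0.

Definition carrier (B : Type) (U : B -> pmetric) (s : option B) : pmetric :=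
  if s is Some b then U b else real_pmetric.

Definition in_ball (V : pmetric) (r : R) (x : V) : Prop := mdist (anchor V) x <= r.

Definition in_open_ball (V : pmetric) (r : R) (x : V) : Prop := mdist (anchor V) x < r.

Section BoundedUniformlyContinuous.
Variables (I : finType) (V : I -> pmetric) (W : pmetric).
Variable h : (forall j, V j) -> W.

Definition bounded_on_balls : Prop :=
  forall r : R, exists C : R, forall a, (forall j, in_ball r (a j)) -> in_ball C (h a).

Definition ucont_on_balls : Prop :=
  forall r e : R, 0 < e -> exists2 del : R, 0 < del &
    forall a a', (forall j, in_ball r (a j)) -> (forall j, in_ball r (a' j)) ->
      (forall j, mdist (a j) (a' j) < del) -> mdist (h a) (h a') < e.

End BoundedUniformlyContinuous.

Record structure (L : signature) := Structure {
  univ : base L -> pmetric;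
  interp : forall f : sym L,
    (forall j : arg f, carrier univ (dom j)) -> carrier univ (cod f);
  interp_bounded : forall f, bounded_on_balls (@interp f);
  interp_ucont : forall f, ucont_on_balls (@interp f)
}.

Definition car (L : signature) (M : structure L) (s : sort L) : pmetric :=
  carrier (univ M) s.

Coercion car : structure >-> Funclass.

End Structures.

Section Syntax.
Variable L : signature.

(* [X] is the type of free variables and [sg] assigns their sorts. *)
Inductive term (X : Type) (sg : X -> sort L) : sort L -> Type :=
| Var (x : X) : term sg (sg x)
| App (f : sym L) : (forall j : arg f, term sg (dom j)) -> term sg (cod f)
| Dist (s : sort L) : term sg s -> term sg s -> term sg None.

(* [None : option X] is the newly bound variable. *)
Definition bind (X : Type) (sg : X -> sort L) (s : sort L) (v : option X) : sort L :=
  if v is Some x then sg x else s.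

Inductive formula (X : Type) (sg : X -> sort L) : Type :=
| Le : term sg None -> rat -> formula sg
| Ge : term sg None -> rat -> formula sg
| And : formula sg -> formula sg -> formula sg
| Or : formula sg -> formula sg -> formula sg
| Ex (s : sort L) : {posnum rat} -> formula (bind sg s) -> formula sg
| All (s : sort L) : {posnum rat} -> formula (bind sg s) -> formula sg.

(* [approx p q] : q is an approximation of p. *)
Fixpoint approx (X : Type) (sg : X -> sort L) (p : formula sg) : formula sg -> Prop :=
  match p with
  | Le t r => fun q => exists2 r', r < r' & q = Le t r'
  | Ge t r => fun q => exists2 r', r' < r & q = Ge t r'
  | And p1 p2 => fun q => exists q1 q2, [/\ approx p1 q1, approx p2 q2 & q = And q1 q2]
  | Or p1 p2 => fun q => exists q1 q2, [/\ approx p1 q1, approx p2 q2 & q = Or q1 q2]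
  | Ex s r p1 => fun q => exists (r' : {posnum rat}) q1,
      [/\ r%:num < r'%:num, approx p1 q1 & q = Ex r' q1]
  | All s r p1 => fun q => exists (r' : {posnum rat}) q1,
      [/\ r'%:num < r%:num, approx p1 q1 & q = All r' q1]
  end.

Definition empty_context (v : void) : sort L := match v with end.

Definition sentence : Type := formula empty_context.

End Syntax.

Section Semantics.
Variables (R : realType) (L : signature).
Implicit Type M : structure R L.

Definition env M (X : Type) (sg : X -> sort L) : Type := forall x, M (sg x).

Fixpoint eval M (X : Type) (sg : X -> sort L) (e : env M sg) (s : sort L)
    (t : term sg s) : M s :=
  match t in term _ s return M s with
  | Var x => e x
  | App f ts => @interp R L M f (fun j => eval e (ts j))
  | Dist s t1 t2 => mdist (eval e t1) (eval e t2)
  end.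

Definition evalR M (X : Type) (sg : X -> sort L) (e : env M sg) (t : term sg None) : R :=
  eval e t.

Definition bind_env M (X : Type) (sg : X -> sort L) (e : env M sg) (s : sort L)
    (a : M s) : env M (bind sg s) :=
  fun v => match v return M (bind sg s v) with Some x => e x | None => a end.

Fixpoint sat M (X : Type) (sg : X -> sort L) (p : formula sg) : env M sg -> Prop :=
  match p with
  | Le t r => fun e => evalR e t <= ratr r
  | Ge t r => fun e => evalR e t >= ratr r
  | And p1 p2 => fun e => sat p1 e /\ sat p2 e
  | Or p1 p2 => fun e => sat p1 e \/ sat p2 e
  | Ex s r p1 => fun e => exists2 a : M s, in_ball (ratr r%:num) a & sat p1 (bind_env e a)
  | All s r p1 => fun e => forall a : M s, in_open_ball (ratr r%:num) a -> sat p1 (bind_env e a)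
  end.

Definition empty_env M : env M (@empty_context L) := fun v => match v with end.

Definition approx_sat M (p : sentence L) : Prop :=
  forall q, approx p q -> sat q (empty_env M).

Definition theory (K : structure R L -> Prop) : set (sentence L) :=
  [set p | forall M, K M -> approx_sat M p].

Definition models M (Th : set (sentence L)) : Prop := forall p, Th p -> approx_sat M p.

(* The free variables of a formula with parameters are the variables
   ['I_n] together with the parameters, the latter being evaluated to
   themselves. *)
Section WithParams.
Variables (M : structure R L) (A : set {s : sort L & M s}) (n : nat) (sg : 'I_n -> sort L).

Definition param_context (v : 'I_n + {p | A p}) : sort L :=
  match v with inl i => sg i | inr p => tag (sval p) end.

Definition param_env (b : env M sg) : env M param_context :=
  fun v => match v return M (param_context v) with
           | inl i => b i
           | inr p => tagged (sval p)
           end.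

End WithParams.

Definition saturated M : Prop :=
  forall A : set {s : sort L & M s}, countable A ->
  forall (n : nat) (sg : 'I_n -> sort L) (rho : 'I_n -> R)
    (Gam : set (formula (param_context (A := A) sg))),
  (forall Del : set (formula (param_context (A := A) sg)), finite_set Del ->
     (forall q, Del q -> exists2 p, Gam p & approx p q) ->
     exists2 b : env M sg, (forall i, in_ball (rho i) (b i)) &
       forall q, Del q -> sat q (param_env b)) ->
  exists2 b : env M sg, (forall i, in_ball (rho i) (b i)) &
    forall p, Gam p -> sat p (param_env b).

End Semantics.

Record extension (L : signature) := Extension {
  xbase : Type;
  xsym : Type;
  xarg : xsym -> finType;
  xdom : forall f : xsym, xarg f -> option (base L + xbase);
  xcod : xsym -> option (base L + xbase)
}.

Definition extend (L : signature) (E : extension L) : signature := {|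
  base := (base L + xbase E)%type;
  sym := (sym L + xsym E)%type;
  arg := fun f => match f with inl f => arg f | inr f => xarg f end;
  dom := fun f => match f
           return match f with inl f => arg f | inr f => xarg f end ->
                  option (base L + xbase E) with
         | inl f => fun j => omap inl (dom j)
         | inr f => fun j => xdom j
         end;
  cod := fun f => match f with inl f => omap inl (cod f) | inr f => xcod f end
|}.

Section Reduct.
Variables (R : realType) (L : signature) (E : extension L).

Section Casts.
Variable U : base L + xbase E -> pmetric R.

(* Both casts are the identity on every sort. *)
Definition to_ext (s : sort L) : carrier (U \o inl) s -> carrier U (omap inl s) :=
  match s with Some b => id | None => id end.

Definition of_ext (s : sort L) : carrier U (omap inl s) -> carrier (U \o inl) s :=
  match s with Some b => id | None => id end.

Lemma mdist_to_ext s x y : mdist (@to_ext s x) (to_ext y) = mdist x y.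
Proof. by case: s x y. Qed.

Lemma mdist_of_ext s x y : mdist (@of_ext s x) (of_ext y) = mdist x y.
Proof. by case: s x y. Qed.

Lemma in_ball_to_ext s r x : in_ball r (@to_ext s x) = in_ball r x.
Proof. by case: s x. Qed.

Lemma in_ball_of_ext s r x : in_ball r (@of_ext s x) = in_ball r x.
Proof. by case: s x. Qed.

End Casts.

Variable M : structure R (extend E).

Definition reduct_interp (f : sym L)
    (a : forall j : arg f, carrier (univ M \o inl) (dom j)) :
    carrier (univ M \o inl) (cod f) :=
  of_ext (@interp R (extend E) M (inl f) (fun j => to_ext (a j))).

Lemma reduct_bounded f : bounded_on_balls (@reduct_interp f).
Proof.
move=> r; have [C hC] := @interp_bounded R _ M (inl f) r.
exists C => a ha; rewrite /reduct_interp in_ball_of_ext.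
by apply: hC => j; rewrite in_ball_to_ext; exact: ha.
Qed.

Lemma reduct_ucont f : ucont_on_balls (@reduct_interp f).
Proof.
move=> r e e0; have [del del0 hdel] := @interp_ucont R _ M (inl f) r e e0.
exists del => // a a' ha ha' haa'; rewrite /reduct_interp mdist_of_ext.
apply: hdel => j; first by rewrite in_ball_to_ext; exact: ha.
  by rewrite in_ball_to_ext; exact: ha'.
by rewrite mdist_to_ext; exact: haa'.
Qed.

Definition reduct : structure R L := Structure reduct_bounded reduct_ucont.

End Reduct.

(* Symbols with at most two arguments; [option B] is a set of sorts. *)
Inductive profile (B : Type) :=
| Nullary of option B
| Unary of option B & option B
| Binary of option B & option B & option B.

Section Profile.
Variable B : Type.
Implicit Type p : profile B.

Definition parg p : finType :=
  match p with Nullary _ => void | Unary _ _ => unit | Binary _ _ _ => bool end.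

Definition pdom p : parg p -> option B :=
  match p return parg p -> option B with
  | Nullary _ => fun v => match v with end
  | Unary s _ => fun=> s
  | Binary s1 s2 _ => fun b => if b then s1 else s2
  end.

Definition pcod p : option B :=
  match p with Nullary t => t | Unary _ t => t | Binary _ _ t => t end.

Variables (R : realType) (C : option B -> pmetric R).

Definition curried p : Type :=
  match p with
  | Nullary t => C t
  | Unary s t => C s -> C t
  | Binary s1 s2 t => C s1 -> C s2 -> C t
  end.

Definition pcurry p : ((forall j : parg p, C (pdom j)) -> C (pcod p)) -> curried p :=
  match p return ((forall j : parg p, C (pdom j)) -> C (pcod p)) -> curried p with
  | Nullary t => fun h => h (fun v => match v with end)
  | Unary s t => fun h x => h (fun=> x)
  | Binary s1 s2 t => fun h x y =>
      h (fun b => match b return C (if b then s1 else s2) with true => x | false => y end)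
  end.

End Profile.

Inductive rbase := Points | Algebra | LinfR | Measures.

Inductive rsym :=
| RRat of rat | RAdd | RMul | RAbs | RMin | RMax
| OmegaPt
| AEmpty | AFull | AUnion | AInter | ACompl | AMem | ASing
| LZero | LAdd | LScale | LNorm | LMin | LMax | LAbs | LEval | LChi
| MZero | MAdd | MScale | MNorm | MDirac | MEval | MVar
| Integ.

Definition rprofile (f : rsym) : profile rbase :=
  let Rs := None in let Om := Some Points in let Al := Some Algebra in
  let Li := Some LinfR in let Me := Some Measures in
  match f with
  | RRat _ => Nullary Rs
  | RAdd | RMul | RMin | RMax => Binary Rs Rs Rs
  | RAbs => Unary Rs Rs
  | OmegaPt => Nullary Om
  | AEmpty | AFull => Nullary Al
  | AUnion | AInter => Binary Al Al Al
  | ACompl => Unary Al Al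
  | AMem => Binary Om Al Rs
  | ASing => Unary Om Al
  | LZero => Nullary Li
  | LAdd | LMin | LMax => Binary Li Li Li
  | LScale => Binary Rs Li Li
  | LNorm => Unary Li Rs
  | LAbs => Unary Li Li
  | LEval => Binary Li Om Rs
  | LChi => Unary Al Li
  | MZero => Nullary Me
  | MAdd => Binary Me Me Me
  | MScale => Binary Rs Me Me
  | MNorm => Unary Me Rs
  | MDirac => Unary Om Me
  | MEval => Binary Me Al Rs
  | MVar => Unary Me Me
  | Integ => Binary Li Me Rs
  end.

Definition real_signature : signature := {|
  base := rbase;
  sym := rsym;
  arg := fun f => parg (rprofile f);
  dom := fun f => @pdom _ (rprofile f);
  cod := fun f => pcod (rprofile f)
|}.

Definition sOm : sort real_signature := Some Points.
Definition sAl : sort real_signature := Some Algebra.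
Definition sLi : sort real_signature := Some LinfR.
Definition sMe : sort real_signature := Some Measures.

Section Classical.
Variable R : realType.

Definition rop (M : structure R real_signature) (f : rsym) : curried M (rprofile f) :=
  @pcurry _ _ M (rprofile f) (@interp R real_signature M f).

Local Open Scope ereal_scope.

(* The integral of f against a signed measure, through the Jordan
   decomposition given by a chosen Hahn decomposition. *)
Definition charge_integral d (T : measurableType d) (nu : {charge set T -> \bar R})
    (f : T -> R) : R :=
  let HN := projT2 (cid (Hahn_decomposition nu)) in
  let nuPN := projT2 (cid HN) in
  (\int[jordan_pos nuPN]_x f x - \int[jordan_neg nuPN]_x f x)%R.

Definition abs_split d (T : measurableType d) (nu : {charge set T -> \bar R})
    (A : set T) : \bar R :=
  ereal_sup [set `|nu (A `&` B)| + `|nu (A `&` ~` B)| | B in measurable].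

(* The structure M is, up to renaming the elements of its sorts along [pt],
   [st], [fu] and [ch], the classical framework on the measurable space T.
   A charge is a function on all sets whose values matter on measurable sets
   only, hence the form of [ch_inj] and [ch_surj]. *)
Record classical_on (M : structure R real_signature) d (T : measurableType d)
    (pt : M sOm -> T) (st : M sAl -> set T) (fu : M sLi -> T -> R)
    (ch : M sMe -> {charge set T -> \bar R}) : Prop := {
  sing_measurable : forall x : T, measurable [set x];

  pt_bij : bijective pt;
  st_inj : injective st;
  st_range : range st = measurable;
  fu_inj : injective fu;
  fu_range : range fu =
    [set f : T -> R | measurable_fun setT f /\ exists C : R, forall x, (`|f x| <= C)%R];
  ch_inj : forall mu nu, (forall A, measurable A -> ch mu A = ch nu A) -> mu = nu;
  ch_surj : forall nu : {charge set T -> \bar R},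
    exists mu, forall A, measurable A -> ch mu A = nu A;

  pt_dist : forall x y : M sOm, mdist x y = ((x != y)%:R)%R;
  st_dist : forall S S' : M sAl, mdist S S' = ((S != S')%:R)%R;
  fu_dist : forall f g : M sLi,
    mdist f g = rop M LNorm (rop M LAdd f (rop M LScale (-1)%R g));
  ch_dist : forall mu nu : M sMe,
    mdist mu nu = rop M MNorm (rop M MAdd mu (rop M MScale (-1)%R nu));

  pt_anchor : anchor (M sOm) = rop M OmegaPt;
  st_anchor : anchor (M sAl) = rop M AEmpty;
  fu_anchor : anchor (M sLi) = rop M LZero;
  ch_anchor : anchor (M sMe) = rop M MZero;

  RRatE : forall q, rop M (RRat q) = ratr q;
  RAddE : forall a b : R, rop M RAdd a b = (a + b)%R;
  RMulE : forall a b : R, rop M RMul a b = (a * b)%R;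
  RAbsE : forall a : R, rop M RAbs a = `|a|%R;
  RMinE : forall a b : R, rop M RMin a b = Num.min a b;
  RMaxE : forall a b : R, rop M RMax a b = Num.max a b;

  AEmptyE : st (rop M AEmpty) = set0;
  AFullE : st (rop M AFull) = setT;
  AUnionE : forall S S', st (rop M AUnion S S') = st S `|` st S';
  AInterE : forall S S', st (rop M AInter S S') = st S `&` st S';
  AComplE : forall S, st (rop M ACompl S) = ~` st S;
  AMemE : forall x S, rop M AMem x S = ((pt x \in st S)%:R)%R;
  ASingE : forall x, st (rop M ASing x) = [set pt x];

  LZeroE : forall t, fu (rop M LZero) t = 0%R;
  LAddE : forall f g t, fu (rop M LAdd f g) t = (fu f t + fu g t)%R;
  LScaleE : forall (a : R) f t, fu (rop M LScale a f) t = (a * fu f t)%R;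
  LNormE : forall f, (rop M LNorm f)%:E = ereal_sup (range (fun t => `|fu f t|%:E));
  LMinE : forall f g t, fu (rop M LMin f g) t = Num.min (fu f t) (fu g t);
  LMaxE : forall f g t, fu (rop M LMax f g) t = Num.max (fu f t) (fu g t);
  LAbsE : forall f t, fu (rop M LAbs f) t = `|fu f t|%R;
  LEvalE : forall f x, rop M LEval f x = fu f (pt x);
  LChiE : forall S t, fu (rop M LChi S) t = ((t \in st S)%:R)%R;

  MZeroE : forall A, measurable A -> ch (rop M MZero) A = 0;
  MAddE : forall mu nu A, measurable A -> ch (rop M MAdd mu nu) A = ch mu A + ch nu A;
  MScaleE : forall (a : R) mu A, measurable A -> ch (rop M MScale a mu) A = a%:E * ch mu A;
  MNormE : forall mu, (rop M MNorm mu)%:E =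
    ereal_sup [set `|ch mu A| + `|ch mu (~` A)| | A in measurable];
  MDiracE : forall x A, measurable A -> ch (rop M MDirac x) A = \d_(pt x) A;
  MEvalE : forall mu S, (rop M MEval mu S)%:E = ch mu (st S);
  MVarE : forall mu A, measurable A -> ch (rop M MVar mu) A = abs_split (ch mu) A;

  IntegE : forall f mu, rop M Integ f mu = charge_integral (ch mu) (fu f)
}.

Definition classical_framework (M : structure R real_signature) : Prop :=
  exists d (T : measurableType d) pt st fu ch, @classical_on M d T pt st fu ch.

Definition real_preintegration_framework (M : structure R real_signature) : Prop :=
  models M (theory classical_framework).

End Classical.

Inductive bbase := Banach | LinfB.

Inductive bsym :=
| BZero | BAdd | BScale | BNorm
| FZero | FAdd | FScale | FNorm
| FEval | FMul | FConst | FAbs | Pairing.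

Definition bprofile (f : bsym) : profile (rbase + bbase) :=
  let Rs := None in let Om := Some (inl Points) in
  let Li := Some (inl LinfR) in let Me := Some (inl Measures) in
  let Ba := Some (inr Banach) in let Lb := Some (inr LinfB) in
  match f with
  | BZero => Nullary Ba
  | BAdd => Binary Ba Ba Ba
  | BScale => Binary Rs Ba Ba
  | BNorm => Unary Ba Rs
  | FZero => Nullary Lb
  | FAdd => Binary Lb Lb Lb
  | FScale => Binary Rs Lb Lb
  | FNorm => Unary Lb Rs
  | FEval => Binary Lb Om Ba
  | FMul => Binary Li Lb Lb
  | FConst => Unary Ba Lb
  | FAbs => Unary Lb Li
  | Pairing => Binary Lb Me Ba
  end.

Definition banach_extension : extension real_signature := @Extension real_signature
  bbase bsym (fun f => parg (bprofile f)) (fun f => @pdom _ (bprofile f))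
  (fun f => pcod (bprofile f)).

Definition banach_signature : signature := extend banach_extension.

Definition bOm : sort banach_signature := Some (inl Points).
Definition bLi : sort banach_signature := Some (inl LinfR).
Definition bMe : sort banach_signature := Some (inl Measures).
Definition bBa : sort banach_signature := Some (inr Banach).
Definition bLb : sort banach_signature := Some (inr LinfB).

Section BanachFrameworks.
Variable R : realType.
Implicit Type N : structure R banach_signature.

Definition bop N (f : bsym) : curried N (bprofile f) :=
  @pcurry _ _ N (bprofile f) (@interp R banach_signature N (inr f)).

Definition oldop N (f : rsym) := @rop R (reduct N) f.

(* V with the given operations is, up to a bijection, a real Banach space. *)
Definition is_banach_space (V : pmetric R) (zero : V) (add : V -> V -> V)
    (scale : R -> V -> V) (norm : V -> R) : Prop :=
  exists (W : completeNormedModType R) (h : V -> W), bijective h /\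
    [/\ h zero = 0, forall x y, h (add x y) = h x + h y,
        forall a x, h (scale a x) = a *: h x,
        forall x, norm x = `|h x| & forall x y, mdist x y = `|h x - h y|].

Record banach_expansion N : Prop := {
  expansion_reduct : real_preintegration_framework (reduct N);

  banach_B : is_banach_space (bop N BZero) (bop N BAdd) (bop N BScale) (bop N BNorm);
  banach_F : is_banach_space (bop N FZero) (bop N FAdd) (bop N FScale) (bop N FNorm);
  anchor_B : anchor (N bBa) = bop N BZero;
  anchor_F : anchor (N bLb) = bop N FZero;

  FEval_add : forall F G x,
    bop N FEval (bop N FAdd F G) x = bop N BAdd (bop N FEval F x) (bop N FEval G x);
  FEval_scale : forall (a : R) F x,
    bop N FEval (bop N FScale a F) x = bop N BScale a (bop N FEval F x);
  FEval_norm : forall F,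
    ((bop N FNorm F)%:E = ereal_sup (range (fun x => (bop N BNorm (bop N FEval F x))%:E)))%E;

  FMul_eval : forall f F x,
    bop N FEval (bop N FMul f F) x = bop N BScale (oldop N LEval f x) (bop N FEval F x);
  FMul_addr : forall f F G,
    bop N FMul f (bop N FAdd F G) = bop N FAdd (bop N FMul f F) (bop N FMul f G);
  FMul_addl : forall f g F,
    bop N FMul (oldop N LAdd f g) F = bop N FAdd (bop N FMul f F) (bop N FMul g F);
  FMul_one : forall F, bop N FMul (oldop N LChi (oldop N AFull)) F = F;
  (* There is no symbol for the product of elements of [LinfR]: fg is any
     element that evaluates to the pointwise product. *)
  FMul_mul : forall f g fg F,
    (forall x, oldop N LEval fg x = (oldop N LEval f x : R) * oldop N LEval g x) ->
    bop N FMul fg F = bop N FMul f (bop N FMul g F);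

  FConst_eval : forall T x, bop N FEval (bop N FConst T) x = T;

  FAbs_eval : forall F x,
    oldop N LEval (bop N FAbs F) x = bop N BNorm (bop N FEval F x);

  Pairing_addl : forall F G mu,
    bop N Pairing (bop N FAdd F G) mu = bop N BAdd (bop N Pairing F mu) (bop N Pairing G mu);
  Pairing_scalel : forall (a : R) F mu,
    bop N Pairing (bop N FScale a F) mu = bop N BScale a (bop N Pairing F mu);
  Pairing_addr : forall F mu nu,
    bop N Pairing F (oldop N MAdd mu nu) = bop N BAdd (bop N Pairing F mu) (bop N Pairing F nu);
  Pairing_scaler : forall (a : R) F mu,
    bop N Pairing F (oldop N MScale a mu) = bop N BScale a (bop N Pairing F mu);
  Pairing_const : forall f T mu,
    bop N Pairing (bop N FMul f (bop N FConst T)) mu = bop N BScale (oldop N Integ f mu) T;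
  Pairing_norm : forall F mu,
    (bop N BNorm (bop N Pairing F mu) : R)
      <= `|oldop N Integ (bop N FAbs F) (oldop N MVar mu) : R|
}.

Definition banach_preintegration_reduct N : Prop := models N (theory banach_expansion).

Variable E : extension banach_signature.
Implicit Type M : structure R (extend E).

Definition banach_preintegration_framework M : Prop :=
  banach_preintegration_reduct (reduct M).

Definition banach_integration_framework M : Prop :=
  banach_preintegration_framework M /\ saturated M.

End BanachFrameworks.

(* Main.v *)
(* If osc <<phi, mu>> exceeded ||mu|| r, with r = sup_x osc phi(x), then along a
   cofinal sequence of indices one could choose functions
   f_n = |phi_j - phi_k| in L^oo with <f_n, |mu|> > s > ||mu|| r. Replacing the
   f_n by finite maxima g_l of terms of their tails whose |mu|-integrals are nearly
   maximal, all finite minima of the g_l still have |mu|-integral at least some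
   s' > ||mu|| r, hence take values above some rational q > r. Saturation gives one
   point x with g_l(x) >= q for all l, i.e. f_n(x) >= q for infinitely many n, so
   that osc phi(x) >= q > r, a contradiction.
   The facts about integrals that this needs are true in the classical
   frameworks, and reach all models of the theory because each of them is a
   family of positive bounded sentences. *)
Require Import Defs.
From mathcomp Require Import all_boot all_order all_algebra.
From mathcomp Require Import all_classical all_reals all_analysis.
From mathcomp Require Import ring lra.
(* MathComp shadows [sort] and [approx]. *)
Import Defs.

Set Implicit Arguments.
Unset Strict Implicit.
Unset Printing Implicit Defensive.

Import Order.TTheory GRing.Theory Num.Theory.
Import numFieldNormedType.Exports.

Local Open Scope classical_set_scope.
Local Open Scope ring_scope.

(** * Transfer of sentences to the models of a theory *)

Section Transfer.
Variables (R : realType) (L : signature).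
Implicit Type M : structure R L.

Lemma sat_approx M (X : Type) (sg : X -> sort L) (p q : formula sg) (e : env M sg) :
  approx p q -> sat p e -> sat q e.
Proof.
elim: p q e => {X sg} [X sg t r|X sg t r|X sg p1 IH1 p2 IH2|X sg p1 IH1 p2 IH2
  |X sg s r p1 IH1|X sg s r p1 IH1] q e /=.
- by case=> r' rr' -> /= h; rewrite (le_trans h)// ler_rat ltW.
- by case=> r' rr' -> /= h; rewrite (le_trans _ h)// ler_rat ltW.
- by case=> q1 [q2 [a1 a2 ->]] /= [h1 h2]; split; [exact: IH1 h1|exact: IH2 h2].
- by case=> q1 [q2 [a1 a2 ->]] /= [h|h]; [left; exact: IH1 h|right; exact: IH2 h].
- case=> r' [q1 [rr' a1 ->]] /= [a ha h]; exists a; last exact: IH1 h.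
  by rewrite /in_ball (le_trans ha)// ler_rat ltW.
- case=> r' [q1 [rr' a1 ->]] /= h a ha; apply: IH1 a1 _; apply: h.
  by rewrite /in_open_ball (lt_trans ha)// ltr_rat.
Qed.

(** Contexts are iterated options: [ctx (s :: l)] unfolds to [bind (ctx l) s], so that a quantifier
    binds the head variable without renaming. *)
Fixpoint ctx_var (l : seq (sort L)) : Type :=
  if l is _ :: l' then option (ctx_var l') else void.

Fixpoint ctx (l : seq (sort L)) : ctx_var l -> sort L :=
  match l with
  | [::] => @empty_context L
  | s :: l' => bind (@ctx l') s
  end.

(** One radius serves all quantifiers; every environment is reached for some radius, since its
    values are finitely many ([env_bounded]). *)
Fixpoint forall_closure (r : {posnum rat}) (l : seq (sort L)) :
    formula (@ctx l) -> sentence L :=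
  match l with
  | [::] => id
  | s :: l' => fun p => forall_closure r (All r p)
  end.

Lemma approx_closure (r r' : {posnum rat}) l (p q : formula (@ctx l)) :
  r'%:num < r%:num -> approx p q -> approx (forall_closure r p) (forall_closure r' q).
Proof.
move=> rr'; elim: l p q => [//|s l IH] p q pq.
by apply: IH => /=; exists r', q.
Qed.

Lemma sat_closure M (r : {posnum rat}) l (p : formula (@ctx l)) :
  (forall e : env M (@ctx l), sat p e) -> sat (forall_closure r p) (empty_env M).
Proof. by elim: l p => [|s l IH] p h; [exact: h|apply: IH => e a _; exact: h]. Qed.

Lemma closure_sat M (r : {posnum rat}) l (p : formula (@ctx l)) (e : env M (@ctx l)) :
  (forall v, in_open_ball (ratr r%:num) (e v)) ->
  sat (forall_closure r p) (empty_env M) -> sat p e.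
Proof.
elim: l p e => [|s l IH] p e he.
  by rewrite (_ : e = empty_env M)//; apply: functional_extensionality_dep; case.
move=> h; have /= := IH (All r p) (fun v => e (Some v)) (fun v => he (Some v)) h.
move=> /(_ (e None) (he None)); congr sat.
by apply: functional_extensionality_dep; case.
Qed.

Lemma env_bounded M l (e : env M (@ctx l)) :
  exists r : {posnum rat}, forall v, in_open_ball (ratr r%:num) (e v).
Proof.
elim: l e => [|s l IH] e; first by exists 1%:pos => -[].
have [r hr] := IH (fun v => e (Some v)).
have [n hn] : exists n : nat, mdist (anchor (M s)) (e None) < n%:R.
  by exists (Num.truncn (mdist (anchor (M s)) (e None))).+1; exact: truncnS_gt.
have np : 0 < r%:num + n%:R :> rat by rewrite ltr_pwDl.
exists (PosNum np) => -[v|]; rewrite /in_open_ball /= rmorphD/= ratr_nat.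
  by rewrite (lt_le_trans (hr v))// lerDl.
by rewrite (lt_le_trans hn)// lerDr ler0q.
Qed.

(** The universal closure of [p] at any radius belongs to the theory of [K]. Approximation shrinks
    the radius of a universal quantifier, so the closure is taken at [r + 1], which leaves the
    radius [r] of balls containing the values of [e]. *)
Lemma transfer (K : structure R L -> Prop) (N : structure R L) l (p q : formula (@ctx l)) :
  models N (theory K) -> (forall M, K M -> forall e : env M (@ctx l), sat p e) ->
  approx p q -> forall e : env N (@ctx l), sat q e.
Proof.
move=> hN hK pq e; have [r hr] := env_bounded e.
have rp : 0 < r%:num + 1 :> rat by rewrite ltr_pwDl.
apply: (closure_sat hr); apply: (hN (forall_closure (PosNum rp) p)).
- by move=> M KM q'; move/sat_approx; apply; apply: sat_closure; exact: hK.
- by apply: approx_closure => //=; rewrite ltrDl.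
Qed.

(** The complement of an open box, as a positive formula. For lack of a formula for falsity, the
    fold starts from a repeated disjunct, supplied by the nonempty index type ['I_k.+1]. *)
Definition outside (X : Type) (sg : X -> sort L) k (t : 'I_k.+1 -> term sg None)
    (a b : 'I_k.+1 -> rat) : formula sg :=
  foldr (fun i p => Or (Or (Le (t i) (a i)) (Ge (t i) (b i))) p)
    (Le (t ord0) (a ord0)) (enum 'I_k.+1).

Lemma sat_outside M (X : Type) (sg : X -> sort L) k (t : 'I_k.+1 -> term sg None)
    (a b : 'I_k.+1 -> rat) (e : env M sg) :
  sat (outside t a b) e <->
  exists i, evalR e (t i) <= ratr (a i) \/ ratr (b i) <= evalR e (t i).
Proof.
rewrite /outside; split.
  by elim: (enum _) => [|i s IH] /=; [exists ord0; left|case=> [h|/IH//]; exists i].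
case=> i h; have : i \in enum 'I_k.+1 by rewrite mem_enum.
elim: (enum _) => [//|j s IH]; rewrite inE => /predU1P[<-|/IH ?]; first by left.
by right.
Qed.

Lemma approx_outside (X : Type) (sg : X -> sort L) k (t : 'I_k.+1 -> term sg None)
    (a b a' b' : 'I_k.+1 -> rat) :
  (forall i, a i < a' i) -> (forall i, b' i < b i) ->
  approx (outside t a b) (outside t a' b').
Proof.
move=> aa' bb'; rewrite /outside; elim: (enum _) => [|i s IH] /=.
  by exists (a' ord0).
do 2 eexists; split; [|exact: IH|reflexivity].
by do 2 eexists; split; [exists (a' i)|exists (b' i)|].
Qed.

Lemma rat_between (x y : R) : x < y -> exists q : rat, x < ratr q < y.
Proof.
move=> xy; have [q] := rat_in_itvoo xy.
by rewrite in_itv/= => ?; exists q.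
Qed.

(* A closed condition on the values of finitely many real terms fails on a whole
   rational box as soon as it fails at a point, so that it is a conjunction of
   formulas [outside t a b]. *)
Lemma transfer_le (K : structure R L -> Prop) (N : structure R L) l k
    (t : 'I_k.+1 -> term (@ctx l) None) (Phi : 'rV[R]_k.+1 -> R) :
  models N (theory K) -> continuous Phi ->
  (forall M, K M -> forall e : env M (@ctx l), Phi (\row_i evalR e (t i)) <= 0) ->
  forall e : env N (@ctx l), Phi (\row_i evalR e (t i)) <= 0.
Proof.
move=> hN cPhi hK e; rewrite leNgt; apply/negP => Phi0.
set v := (X in Phi X) in Phi0.
have := cPhi v; move=> /(_ [set y | 0 < y]) /=.
case/(_ _)/nbhs_ballP => [|d /= d0 hd].
  by apply: open_nbhs_nbhs; split => //; exact: open_gt.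
(* Two rational boxes around [v]: the inner one (second components) lies strictly inside the outer
   one (first components), where [Phi] stays positive. Members of [K] avoid the outer box, so the
   values at [e] avoid the inner box, although it contains [v]. *)
have lo i : exists q : rat * rat, [/\ v 0 i - d < ratr q.1 :> R, q.1 < q.2 & ratr q.2 < v 0 i].
  have [|q1 /andP[h1 h2]] := @rat_between (v 0 i - d) (v 0 i); first by rewrite ltrBlDr ltrDl.
  have [q2 /andP[h3 h4]] := rat_between h2.
  by exists (q1, q2); split => //=; rewrite -(ltr_rat R).
have hi i : exists q : rat * rat, [/\ v 0 i < ratr q.2 :> R, q.2 < q.1 & ratr q.1 < v 0 i + d].
  have [|q1 /andP[h1 h2]] := @rat_between (v 0 i) (v 0 i + d); first by rewrite ltrDl.
  have [q2 /andP[h3 h4]] := rat_between h1.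
  by exists (q1, q2); split => //=; rewrite -(ltr_rat R).
have {lo}[a ha] := choice lo; have {hi}[b hb] := choice hi.
have aq : approx (outside t (fst \o a) (fst \o b)) (outside t (snd \o a) (snd \o b)).
  by apply: approx_outside => i /=; [have [] := ha i|have [] := hb i].
suff /(transfer hN)/(_ aq e)/sat_outside[i] : forall M, K M ->
    forall e' : env M (@ctx l), sat (outside t (fst \o a) (fst \o b)) e'.
  have := ha i; have := hb i; rewrite /= !mxE => -[b1 _ _] [_ _ a1] [].
    by rewrite leNgt a1.
  by rewrite leNgt b1.
move=> M KM e'; apply/sat_outside; apply: contrapT => /forallNP hn.
have := hK M KM e'; rewrite leNgt => /negP; apply; apply: hd; split=> // i j.
have /not_orP[/negP + /negP] := hn j; rewrite -!ltNge /= => h1 h2.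
have [a1 _ _] := ha j; have [_ _ b1] := hb j.
rewrite [X in ball X _ _](_ : _ = v 0 j) ?ord1// /ball /= mxE.
by rewrite distrC ltr_distl (lt_trans a1)//= (lt_trans _ b1).
Qed.

End Transfer.

(** * Continuity of the conditions to be transferred *)

Section ContinuousFunctions.
Variables (R : realType) (T : topologicalType).
Implicit Types f g : T -> R.

Lemma continuous_fun_norm f : continuous f -> continuous (fun x => `|f x|).
Proof. by move=> cf x; apply: cvg_norm; exact: cf. Qed.

Lemma continuous_fun_sub f g : continuous f -> continuous g -> continuous (fun x => f x - g x).
Proof. by move=> cf cg x; apply: cvgB; [exact: cf|exact: cg]. Qed.

Lemma continuous_fun_add f g : continuous f -> continuous g -> continuous (fun x => f x + g x).
Proof. by move=> cf cg x; apply: cvgD; [exact: cf|exact: cg]. Qed.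

Lemma continuous_fun_mul f g : continuous f -> continuous g -> continuous (fun x => f x * g x).
Proof. by move=> cf cg x; apply: cvgM; [exact: cf|exact: cg]. Qed.

Lemma continuous_fun_max f g :
  continuous f -> continuous g -> continuous (fun x => Num.max (f x) (g x)).
Proof. by move=> cf cg x; apply: continuous_max; [exact: cf|exact: cg]. Qed.

Lemma continuous_fun_min f g :
  continuous f -> continuous g -> continuous (fun x => Num.min (f x) (g x)).
Proof. by move=> cf cg x; apply: continuous_min; [exact: cf|exact: cg]. Qed.

End ContinuousFunctions.

Lemma row_continuous (R : realType) k (i : 'I_k.+1) : continuous (fun v : 'rV[R]_k.+1 => v 0 i).
Proof. exact: coord_continuous. Qed.

Ltac prove_continuous :=
  repeat lazymatch goal with
  | |- continuous (fun v => `|@?f v|) => apply: (@continuous_fun_norm _ _ f)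
  | |- continuous (fun v => @?f v - @?g v) => apply: (@continuous_fun_sub _ _ f g)
  | |- continuous (fun v => @?f v + @?g v) => apply: (@continuous_fun_add _ _ f g)
  | |- continuous (fun v => @?f v * @?g v) => apply: (@continuous_fun_mul _ _ f g)
  | |- continuous (fun v => Num.max (@?f v) (@?g v)) => apply: (@continuous_fun_max _ _ f g)
  | |- continuous (fun v => Num.min (@?f v) (@?g v)) => apply: (@continuous_fun_min _ _ f g)
  | |- continuous (fun v => fun_of_matrix v _ _) => exact: row_continuous
  | |- _ => exact: cst_continuous
  end.

Lemma transfer_eq (R : realType) (L : signature) (K : structure R L -> Prop)
    (N : structure R L) l k
    (t : 'I_k.+1 -> term (@ctx _ l) None) (Phi : 'rV[R]_k.+1 -> R) :
  models N (theory K) -> continuous Phi ->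
  (forall M, K M -> forall e : env M (@ctx _ l), Phi (\row_i evalR e (t i)) = 0) ->
  forall e : env N (@ctx _ l), Phi (\row_i evalR e (t i)) = 0.
Proof.
move=> hN cPhi h e; apply/normr0_eq0/eqP; rewrite eq_le normr_ge0 andbT.
apply: (@transfer_le _ _ _ _ l _ t (fun v => `|Phi v|) hN) => [|M KM e'].
  exact: (@continuous_fun_norm _ _ Phi).
by rewrite h// normr0.
Qed.

(** * Reducts *)

Section ReductTransfer.
Variables (R : realType) (L : signature) (E : extension L).

Section Translation.
Variables (X : Type) (sg : X -> sort L) (sg' : X -> sort (extend E)).
Hypothesis sgE : forall x, sg' x = omap inl (sg x).

(** Under a binder the two contexts agree only variable by variable, hence the pointwise hypothesis
    [sgE] and the transport at variables. *)
Fixpoint tr_term (s : sort L) (t : term sg s) : term sg' (omap inl s) :=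
  match t in term _ s return term sg' (omap inl s) with
  | Var x => eq_rect (sg' x) (term sg') (Var sg' x) (omap inl (sg x)) (sgE x)
  | App f ts => @App (extend E) X sg' (inl f) (fun j => tr_term (ts j))
  | Dist s t1 t2 => Dist (tr_term t1) (tr_term t2)
  end.

End Translation.

(** Defined by a match ending in [erefl], so that the transport at the bound variable computes away
    in [env_reduct_bind]. *)
Definition bindE (X : Type) (sg : X -> sort L) (sg' : X -> sort (extend E))
    (sgE : forall x, sg' x = omap inl (sg x)) (s : sort L) (v : option X) :
    bind sg' (omap inl s) v = omap inl (bind sg s v) :=
  match v with Some x => sgE x | None => erefl end.

Fixpoint tr_formula (X : Type) (sg : X -> sort L) (p : formula sg) :
    forall (sg' : X -> sort (extend E)), (forall x, sg' x = omap inl (sg x)) ->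
    formula sg' :=
  match p with
  | Le t r => fun sg' H => @Le (extend E) _ sg' (tr_term H t) r
  | Ge t r => fun sg' H => @Ge (extend E) _ sg' (tr_term H t) r
  | And p1 p2 => fun sg' H => And (tr_formula p1 H) (tr_formula p2 H)
  | Or p1 p2 => fun sg' H => Or (tr_formula p1 H) (tr_formula p2 H)
  | Ex s r p1 => fun sg' H => Ex r (tr_formula p1 (bindE H s))
  | All s r p1 => fun sg' H => All r (tr_formula p1 (bindE H s))
  end.

Lemma approx_tr (X : Type) (sg : X -> sort L) (p q : formula sg)
    (sg' : X -> sort (extend E)) (H : forall x, sg' x = omap inl (sg x)) :
  approx p q -> approx (tr_formula p H) (tr_formula q H).
Proof.
elim: p q sg' H => {X sg} [X sg t r|X sg t r|X sg p1 IH1 p2 IH2|X sg p1 IH1 p2 IH2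
  |X sg s r p1 IH1|X sg s r p1 IH1] q sg' H /=.
- by case=> r' rr' ->; exists r'.
- by case=> r' rr' ->; exists r'.
- by case=> q1 [q2 [a1 a2 ->]]; do 2 eexists; split; [exact: IH1 a1|exact: IH2 a2|].
- by case=> q1 [q2 [a1 a2 ->]]; do 2 eexists; split; [exact: IH1 a1|exact: IH2 a2|].
- by case=> r' [q1 [rr' a1 ->]]; do 2 eexists; split; [exact: rr'|exact: IH1 a1|].
- by case=> r' [q1 [rr' a1 ->]]; do 2 eexists; split; [exact: rr'|exact: IH1 a1|].
Qed.

(** Approximate satisfaction of a translated sentence ranges over all its approximations; none of
    them leaves the image of the translation. *)
Lemma approx_tr_inv (X : Type) (sg : X -> sort L) (p : formula sg)
    (sg' : X -> sort (extend E)) (H : forall x, sg' x = omap inl (sg x)) q' :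
  approx (tr_formula p H) q' -> exists2 q, approx p q & q' = tr_formula q H.
Proof.
elim: p sg' H q' => {X sg} [X sg t r|X sg t r|X sg p1 IH1 p2 IH2|X sg p1 IH1 p2 IH2
  |X sg s r p1 IH1|X sg s r p1 IH1] sg' H q' /=.
- by case=> r' rr' ->; exists (Le t r') => //; exists r'.
- by case=> r' rr' ->; exists (Ge t r') => //; exists r'.
- case=> _ [_ [/IH1[q1 ? ->] /IH2[q2 ? ->] ->]].
  by exists (And q1 q2) => //; exists q1, q2.
- case=> _ [_ [/IH1[q1 ? ->] /IH2[q2 ? ->] ->]].
  by exists (Or q1 q2) => //; exists q1, q2.
- case=> r' [_ [rr' /IH1[q1 ? ->] ->]].
  by exists (Ex r' q1) => //; exists r', q1.
- case=> r' [_ [rr' /IH1[q1 ? ->] ->]].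
  by exists (All r' q1) => //; exists r', q1.
Qed.

Variable M : structure R (extend E).

Lemma of_extK s : cancel (@of_ext R L E (univ M) s) (@to_ext R L E (univ M) s).
Proof. by case: s. Qed.

Lemma in_open_ball_to_ext s r (x : reduct M s) :
  in_open_ball r (@to_ext R L E (univ M) s x) = in_open_ball r x.
Proof. by case: s x. Qed.

Definition env_reduct (X : Type) (sg : X -> sort L) (sg' : X -> sort (extend E))
    (H : forall x, sg' x = omap inl (sg x)) (e' : env M sg') (e : env (reduct M) sg) :=
  forall x, eq_rect (sg' x) (fun s => M s) (e' x) (omap inl (sg x)) (H x)
            = @to_ext R L E (univ M) (sg x) (e x).

Lemma eval_tr (X : Type) (sg : X -> sort L) (sg' : X -> sort (extend E))
    (H : forall x, sg' x = omap inl (sg x)) (e' : env M sg') (e : env (reduct M) sg) s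
    (t : term sg s) :
  env_reduct H e' e -> eval e' (tr_term H t) = @to_ext R L E (univ M) s (eval e t).
Proof.
move=> he; elim: t => [x|f ts IH|{}s t1 IH1 t2 IH2] /=.
- by rewrite -he; case: _ / (H x).
- rewrite /reduct_interp of_extK; congr (@interp _ _ M (inl f) _).
  by apply: functional_extensionality_dep => j; exact: IH.
- by rewrite IH1 IH2 mdist_to_ext.
Qed.

Lemma evalR_tr (X : Type) (sg : X -> sort L) (sg' : X -> sort (extend E))
    (H : forall x, sg' x = omap inl (sg x)) (e' : env M sg') (e : env (reduct M) sg)
    (t : term sg None) :
  env_reduct H e' e -> @evalR R (extend E) M X sg' e' (tr_term H t) = evalR e t.
Proof. exact: (@eval_tr X sg sg' H e' e None t). Qed.

Lemma env_reduct_bind (X : Type) (sg : X -> sort L) (sg' : X -> sort (extend E))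
    (H : forall x, sg' x = omap inl (sg x)) (e' : env M sg') (e : env (reduct M) sg) s
    (a : reduct M s) :
  env_reduct H e' e ->
  env_reduct (bindE H s) (bind_env e' (@to_ext R L E (univ M) s a)) (bind_env e a).
Proof. by move=> he [x|] /=; [exact: he|]. Qed.

Lemma sat_tr (X : Type) (sg : X -> sort L) (p : formula sg) (sg' : X -> sort (extend E))
    (H : forall x, sg' x = omap inl (sg x)) (e' : env M sg') (e : env (reduct M) sg) :
  env_reduct H e' e -> sat (tr_formula p H) e' <-> sat p e.
Proof.
elim: p sg' H e' e => {X sg} [X sg t r|X sg t r|X sg p1 IH1 p2 IH2|X sg p1 IH1 p2 IH2
  |X sg s r p1 IH1|X sg s r p1 IH1] sg' H e' e he /=.
- by rewrite (evalR_tr _ he).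
- by rewrite (evalR_tr _ he).
- by rewrite (IH1 _ _ _ _ he) (IH2 _ _ _ _ he).
- by rewrite (IH1 _ _ _ _ he) (IH2 _ _ _ _ he).
- split=> -[a ha h].
    exists (@of_ext R L E (univ M) s a); first by rewrite in_ball_of_ext.
    by move: h; rewrite -{1}[a]of_extK (IH1 _ _ _ _ (env_reduct_bind _ he)).
  exists (@to_ext R L E (univ M) s a); first by rewrite in_ball_to_ext.
  by rewrite (IH1 _ _ _ _ (env_reduct_bind _ he)).
- split=> h a ha.
    rewrite -(IH1 _ _ _ _ (env_reduct_bind _ he)); apply: h.
    by rewrite in_open_ball_to_ext.
  rewrite -[a]of_extK (IH1 _ _ _ _ (env_reduct_bind _ he)); apply: h.
  by rewrite -in_open_ball_to_ext of_extK.
Qed.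

End ReductTransfer.

(** The translation of a sentence in the theory of [K] lies in the theory of [K'], because the
    reducts of members of [K'] approximately satisfy that sentence. *)
Lemma models_reduct (R : realType) (L : signature) (E : extension L)
    (K : structure R L -> Prop) (K' : structure R (extend E) -> Prop)
    (N : structure R (extend E)) :
  (forall M, K' M -> models (reduct M) (theory K)) ->
  models N (theory K') -> models (reduct N) (theory K).
Proof.
move=> hK hN p pK.
pose H (v : void) : @empty_context (extend E) v = omap inl (@empty_context L v) :=
  match v with end.
have he (M : structure R (extend E)) : env_reduct H (empty_env M) (empty_env (reduct M)) by case.
move=> q pq; apply: (proj1 (sat_tr q (he N))); apply: (hN (tr_formula p H)).
  move=> M KM q' /approx_tr_inv[q0 pq0 ->].
  apply: (proj2 (sat_tr q0 (he M))); exact: hK KM _ pK _ pq0.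
exact: approx_tr.
Qed.

(** * Integration against a charge *)

Section ChargeIntegral.
Variables (R : realType) (d : measure_display) (T : measurableType d).
Implicit Types (nu : {charge set T -> \bar R}) (f g : T -> R).

Definition bounded_measurable f : Prop :=
  measurable_fun setT f /\ exists C : R, forall x, `|f x| <= C.

Lemma bounded_measurable_integrable (m : {finite_measure set T -> \bar R}) f :
  bounded_measurable f -> m.-integrable setT (EFin \o f).
Proof.
case=> mf [C hC]; apply: measurable_bounded_integrable => //.
  by rewrite ltey_eq fin_num_measure.
by exists C; split; rewrite ?num_real// => y Cy x _; exact: le_trans (hC x) (ltW Cy).
Qed.

Lemma charge_integralD nu f g : bounded_measurable f -> bounded_measurable g ->
  charge_integral nu (fun x => f x + g x) = charge_integral nu f + charge_integral nu g.
Proof.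
move=> bf bg; rewrite /charge_integral.
by rewrite !RintegralD//; [ring| exact: bounded_measurable_integrable..].
Qed.

Lemma charge_integralZ nu (a : R) f : bounded_measurable f ->
  charge_integral nu (fun x => a * f x) = a * charge_integral nu f.
Proof.
move=> bf; rewrite /charge_integral !RintegralZl//.
- by rewrite mulrBr.
- exact: bounded_measurable_integrable.
- exact: bounded_measurable_integrable.
Qed.

(** For nonnegative [nu] the negative part has total mass 0 and the positive part at most [nu setT].
    The Hahn decomposition is arbitrary because [charge_integral] uses a chosen one. *)
Lemma jordan_integral_le nu (P N : set T) (h : hahn_decomposition nu P N) f (c : R) :
  (forall A, measurable A -> (0 <= nu A)%E) ->
  bounded_measurable f -> 0 <= c -> (forall x, f x <= c) ->
  \int[jordan_pos h]_x f x - \int[jordan_neg h]_x f x <= c * fine (nu setT).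
Proof.
move=> nu0 bf c0 fc; have [[mP _] [mN _] PNT PN0] := h.
have negT : jordan_neg h setT = 0%E.
  apply/eqP; rewrite eq_le measure_ge0 andbT jordan_negE cjordan_negE /crestr0 mem_set//.
  by rewrite /crestr leeNl oppe0; apply: nu0; rewrite setTI.
have posT : (jordan_pos h setT <= nu setT)%E.
  rewrite jordan_posE cjordan_posE /crestr0 mem_set// /crestr setTI.
  rewrite (charge_partition nu measurableT mP mN)//.
  by rewrite !setTI leeDl//; exact: nu0.
have fN : \int[jordan_neg h]_x f x >= 0.
  have [mf [C hC]] := bf.
  (* Here 0 is rewritten as the integral of the constant [- C] against a measure of mass 0, so that
     monotonicity applies. *)
  rewrite [leLHS](_ : _ = \int[jordan_neg h]_(x in setT) (- C)).
    apply: le_Rintegral => //.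
    - apply: bounded_measurable_integrable; split; first exact: measurable_cst.
      by exists `|- C|.
    - exact: bounded_measurable_integrable.
    - by move=> x _; have := hC x; rewrite ler_norml => /andP[].
  by rewrite Rintegral_cst// [X in fine X]negT mulr0.
rewrite lerBlDr (@le_trans _ _ (c * fine (nu setT)))// ?lerDl//.
rewrite (@le_trans _ _ (\int[jordan_pos h]_(x in setT) c))//.
  apply: le_Rintegral => //; first exact: bounded_measurable_integrable.
  apply: bounded_measurable_integrable; split; first exact: measurable_cst.
  by exists `|c|.
by rewrite Rintegral_cst// ler_wpM2l// fine_le//; exact: fin_num_measure.
Qed.

Lemma charge_integral_le nu f (c : R) : (forall A, measurable A -> (0 <= nu A)%E) ->
  bounded_measurable f -> 0 <= c -> (forall x, f x <= c) ->
  charge_integral nu f <= c * fine (nu setT).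
Proof. by move=> nu0 bf c0 fc; exact: jordan_integral_le. Qed.

Lemma abs_split_ge0 nu A : (0 <= abs_split nu A)%E.
Proof.
apply: (@le_trans _ _ (`|nu (A `&` set0)| + `|nu (A `&` ~` set0)|)%E).
  exact: adde_ge0.
by apply: ereal_sup_ubound; exists set0.
Qed.

End ChargeIntegral.

(** * Real pre-integration frameworks *)

Section ProfileApplication.
Variables (B : Type) (R : realType) (C : option B -> pmetric R).

(** A left inverse of [pcurry]: it turns the raw interpretations met when evaluating terms into the
    curried operations that the axioms speak of. *)
Definition papply (p : profile B) :
    curried C p -> (forall j : parg p, C (pdom j)) -> C (pcod p) :=
  match p return curried C p -> (forall j : parg p, C (pdom j)) -> C (pcod p) with
  | Nullary t => fun h _ => h
  | Unary s t => fun h a => h (a tt)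
  | Binary s1 s2 t => fun h a => h (a true) (a false)
  end.

Lemma papplyE (p : profile B) (h : (forall j : parg p, C (pdom j)) -> C (pcod p)) a :
  papply (pcurry h) a = h a.
Proof.
by case: p h a => [t|s t|s1 s2 t] h a /=; congr h;
  apply: functional_extensionality_dep; case.
Qed.

End ProfileApplication.

Definition args1 (L : signature) (X : Type) (sg : X -> sort L) (d : unit -> sort L)
    (t : term sg (d tt)) (j : unit) : term sg (d j) :=
  match j with tt => t end.

Definition args2 (L : signature) (X : Type) (sg : X -> sort L) (d : bool -> sort L)
    (t1 : term sg (d true)) (t2 : term sg (d false)) (j : bool) : term sg (d j) :=
  match j with true => t1 | false => t2 end.

Lemma interp_rop (R : realType) (M : structure R real_signature) (f : rsym)
    (a : forall j : arg (s := real_signature) f, M (dom j)) :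
  @interp R real_signature M f a = papply (rop M f) a.
Proof. by rewrite /rop (papplyE (C := M)). Qed.

Ltac eval_rop := rewrite ?mxE /= /evalR /=; do 4 rewrite ?interp_rop /=.

Section RealFrameworks.
Variable R : realType.
Variables (N : structure R real_signature) (hN : real_preintegration_framework N).

Local Notation rapp f := (@App real_signature _ _ f).

(** Sum and scaling are transferred together: [a = 1] gives sums and [a = -1] differences. *)
Lemma LEval_lin (f g : N sLi) (a : R) (x : N sOm) :
  rop N LEval (rop N LAdd f (rop N LScale a g)) x
  = (rop N LEval f x : R) + a * rop N LEval g x.
Proof.
(* Sorts are listed innermost first: the head of [l] is the variable [None], set by the outermost
   [bind_env] of [e]. *)
pose l : seq (sort real_signature) := [:: sOm; None; sLi; sLi].
pose x' : term (@ctx _ l) sOm := Var (@ctx _ l) None.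
pose a' : term (@ctx _ l) None := Var (@ctx _ l) (Some None).
pose g' : term (@ctx _ l) sLi := Var (@ctx _ l) (Some (Some None)).
pose f' : term (@ctx _ l) sLi := Var (@ctx _ l) (Some (Some (Some None))).
pose t := tnth [tuple
  rapp LEval (args2 (rapp LAdd (args2 f' (rapp LScale (args2 a' g')))) x');
  rapp LEval (args2 f' x'); a'; rapp LEval (args2 g' x')].
pose Phi (v : 'rV[R]_4) : R := v 0 0 - (v 0 1 + v 0 2 * v 0 3).
pose e : env N (@ctx _ l) :=
  bind_env (bind_env (bind_env (bind_env (empty_env N) f) g) (a : N None)) x.
have : Phi (\row_i evalR e (t i)) = 0.
  apply: (@transfer_eq _ _ _ _ l _ t Phi hN) => [|M [d [T [pt [st [fu [ch cM]]]]]] {}e].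
    by rewrite /Phi; prove_continuous.
  rewrite /Phi; eval_rop.
  by rewrite !(LEvalE cM) (LAddE cM) (LScaleE cM) subrr.
by rewrite /Phi; eval_rop; move=> /eqP; rewrite subr_eq0 => /eqP.
Qed.

Lemma LEval_max (f g : N sLi) (x : N sOm) :
  rop N LEval (rop N LMax f g) x = Num.max (rop N LEval f x : R) (rop N LEval g x).
Proof.
pose l : seq (sort real_signature) := [:: sOm; sLi; sLi].
pose x' : term (@ctx _ l) sOm := Var (@ctx _ l) None.
pose g' : term (@ctx _ l) sLi := Var (@ctx _ l) (Some None).
pose f' : term (@ctx _ l) sLi := Var (@ctx _ l) (Some (Some None)).
pose t := tnth [tuple rapp LEval (args2 (rapp LMax (args2 f' g')) x');
  rapp LEval (args2 f' x'); rapp LEval (args2 g' x')].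
pose Phi (v : 'rV[R]_3) : R := v 0 0 - Num.max (v 0 1) (v 0 2).
pose e : env N (@ctx _ l) := bind_env (bind_env (bind_env (empty_env N) f) g) x.
have : Phi (\row_i evalR e (t i)) = 0.
  apply: (@transfer_eq _ _ _ _ l _ t Phi hN) => [|M [d [T [pt [st [fu [ch cM]]]]]] {}e].
    by rewrite /Phi; prove_continuous.
  by rewrite /Phi; eval_rop; rewrite !(LEvalE cM) (LMaxE cM) subrr.
by rewrite /Phi; eval_rop; move=> /eqP; rewrite subr_eq0 => /eqP.
Qed.

Lemma LEval_min (f g : N sLi) (x : N sOm) :
  rop N LEval (rop N LMin f g) x = Num.min (rop N LEval f x : R) (rop N LEval g x).
Proof.
pose l : seq (sort real_signature) := [:: sOm; sLi; sLi].
pose x' : term (@ctx _ l) sOm := Var (@ctx _ l) None.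
pose g' : term (@ctx _ l) sLi := Var (@ctx _ l) (Some None).
pose f' : term (@ctx _ l) sLi := Var (@ctx _ l) (Some (Some None)).
pose t := tnth [tuple rapp LEval (args2 (rapp LMin (args2 f' g')) x');
  rapp LEval (args2 f' x'); rapp LEval (args2 g' x')].
pose Phi (v : 'rV[R]_3) : R := v 0 0 - Num.min (v 0 1) (v 0 2).
pose e : env N (@ctx _ l) := bind_env (bind_env (bind_env (empty_env N) f) g) x.
have : Phi (\row_i evalR e (t i)) = 0.
  apply: (@transfer_eq _ _ _ _ l _ t Phi hN) => [|M [d [T [pt [st [fu [ch cM]]]]]] {}e].
    by rewrite /Phi; prove_continuous.
  by rewrite /Phi; eval_rop; rewrite !(LEvalE cM) (LMinE cM) subrr.
by rewrite /Phi; eval_rop; move=> /eqP; rewrite subr_eq0 => /eqP.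
Qed.

Lemma fu_bounded_measurable (M : structure R real_signature) d (T : measurableType d)
    pt st fu ch : @classical_on R M d T pt st fu ch -> forall f, bounded_measurable (fu f).
Proof.
by move=> cM f; have : range fu (fu f); [exists f|rewrite (fu_range cM)].
Qed.

Lemma Integ_lin (f g : N sLi) (a : R) (mu : N sMe) :
  rop N Integ (rop N LAdd f (rop N LScale a g)) mu
  = (rop N Integ f mu : R) + a * rop N Integ g mu.
Proof.
pose l : seq (sort real_signature) := [:: sMe; None; sLi; sLi].
pose m' : term (@ctx _ l) sMe := Var (@ctx _ l) None.
pose a' : term (@ctx _ l) None := Var (@ctx _ l) (Some None).
pose g' : term (@ctx _ l) sLi := Var (@ctx _ l) (Some (Some None)).
pose f' : term (@ctx _ l) sLi := Var (@ctx _ l) (Some (Some (Some None))).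
pose t := tnth [tuple
  rapp Integ (args2 (rapp LAdd (args2 f' (rapp LScale (args2 a' g')))) m');
  rapp Integ (args2 f' m'); a'; rapp Integ (args2 g' m')].
pose Phi (v : 'rV[R]_4) : R := v 0 0 - (v 0 1 + v 0 2 * v 0 3).
pose e : env N (@ctx _ l) :=
  bind_env (bind_env (bind_env (bind_env (empty_env N) f) g) (a : N None)) mu.
have : Phi (\row_i evalR e (t i)) = 0.
  apply: (@transfer_eq _ _ _ _ l _ t Phi hN) => [|M [d [T [pt [st [fu [ch cM]]]]]] {}e].
    by rewrite /Phi; prove_continuous.
  have bm := fu_bounded_measurable cM.
  rewrite /Phi; eval_rop; rewrite !(IntegE cM) -charge_integralZ// -charge_integralD//.
    rewrite [X in charge_integral _ X](_ : _ = fun y =>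
      fu (e (Some (Some (Some None)))) y + e (Some None) * fu (e (Some (Some None))) y).
      by rewrite subrr.
    by apply/funext => y; rewrite (LAddE cM) (LScaleE cM).
  rewrite [X in bounded_measurable X](_ : _ =
      fu (rop M LScale (e (Some None)) (e (Some (Some None))))) //.
  by apply/funext => y; rewrite (LScaleE cM).
by rewrite /Phi; eval_rop; move=> /eqP; rewrite subr_eq0 => /eqP.
Qed.

Lemma MNorm_ge0 (mu : N sMe) : 0 <= (rop N MNorm mu : R).
Proof.
pose l : seq (sort real_signature) := [:: sMe].
pose t (i : 'I_1) := rapp MNorm (args1 (Var (@ctx _ l) None)).
pose Phi (v : 'rV[R]_1) : R := 0 - v 0 0.
pose e : env N (@ctx _ l) := bind_env (empty_env N) mu.
have : Phi (\row_i evalR e (t i)) <= 0.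
  apply: (@transfer_le _ _ _ _ l _ t Phi hN) => [|M [d [T [pt [st [fu [ch cM]]]]]] {}e].
    by rewrite /Phi; prove_continuous.
  rewrite /Phi; eval_rop; rewrite sub0r oppr_le0 -lee_fin (MNormE cM).
  apply: (@le_trans _ _ (`|ch (e None) set0| + `|ch (e None) (~` set0)|)%E).
    exact: adde_ge0.
  by apply: ereal_sup_ubound; exists set0.
by rewrite /Phi; eval_rop; rewrite sub0r oppr_le0.
Qed.

(** This confines the point sought by saturation to a ball of radius 1. *)
Lemma points_bounded (x y : N sOm) : mdist x y <= 1.
Proof.
pose l : seq (sort real_signature) := [:: sOm; sOm].
pose t (i : 'I_1) := @Dist real_signature _ _ sOm
  (Var (@ctx _ l) None) (Var (@ctx _ l) (Some None)).
pose Phi (v : 'rV[R]_1) : R := v 0 0 - 1.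
pose e : env N (@ctx _ l) := bind_env (bind_env (empty_env N) y) x.
have : Phi (\row_i evalR e (t i)) <= 0.
  apply: (@transfer_le _ _ _ _ l _ t Phi hN) => [|M [d [T [pt [st [fu [ch cM]]]]]] {}e].
    by rewrite /Phi; prove_continuous.
  rewrite /Phi; eval_rop; rewrite subr_le0 (pt_dist cM).
  by case: (_ != _).
by rewrite /Phi; eval_rop; rewrite subr_le0.
Qed.

(** The total variation is a nonnegative charge whose total mass is the norm, so
    [charge_integral_le] applies. *)
Lemma classical_Integ_le (M : structure R real_signature) d (T : measurableType d)
    pt st fu ch : @classical_on R M d T pt st fu ch ->
  forall (f : M sLi) (mu : M sMe) (c : R), 0 <= c ->
    (forall x, (rop M LEval f x : R) <= c) ->
    (rop M Integ f (rop M MVar mu) : R) <= c * rop M MNorm mu.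
Proof.
move=> cM f mu c c0 fc; rewrite (IntegE cM).
(* On the whole space the supremum defining [abs_split] is the one defining the norm. *)
have -> : (rop M MNorm mu : R) = fine (ch (rop M MVar mu) setT).
  rewrite (MVarE cM)// /abs_split -[LHS]/(fine (rop M MNorm mu : R)%:E) (MNormE cM).
  by congr (fine (ereal_sup [set _ | _ in _])); apply/funext => A; rewrite !setTI.
apply: charge_integral_le => //.
- by move=> A mA; rewrite (MVarE cM)//; exact: abs_split_ge0.
- exact: (fu_bounded_measurable cM).
- have [g _ gK] := pt_bij cM.
  by move=> y; rewrite -[y]gK -(LEvalE cM).
Qed.

(** [classical_Integ_le] recast as a positive bounded disjunction: the integral is small, or the
    norm is large, or some point has a large value. Bounding the quantifier over points loses
    nothing, since a discrete space lies in a ball of radius 1. *)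
Lemma Integ_MVar_gt (f : N sLi) (mu : N sMe) (c : R) : 0 <= c ->
  c * rop N MNorm mu < rop N Integ f (rop N MVar mu) ->
  exists x : N sOm, c < rop N LEval f x.
Proof.
set n : R := rop N MNorm mu; set I : R := rop N Integ f _ => c0 cI.
have n0 : 0 <= n := MNorm_ge0 mu.
(* Dividing the slack [I - c * n] by [n + 1], positive even when [n = 0], keeps [c1 * n < I]. *)
have [c1 /andP[cc1 c1I]] : exists c1 : rat, c < ratr c1 < c + (I - c * n) / (n + 1).
  by apply: rat_between; rewrite ltrDl divr_gt0// ?subr_gt0// ltr_wpDl.
have {}c1I : ratr c1 * n < I.
  rewrite (@le_lt_trans _ _ ((c + (I - c * n) / (n + 1)) * n))//.
    by rewrite ler_wpM2r// ltW.
  rewrite mulrDl -ltrBrDl mulrAC ltr_pdivrMr ?ltr_wpDl// mulrDr mulr1 ltrDl subr_gt0//.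
have c1p : 0 < ratr c1 :> R by exact: le_lt_trans cc1.
(* The classical case needs [c1 * b < a]. With [a < a' < I], [n < b' < b] and [c < c2 < c1], the
   relaxed bounds still exclude the first two disjuncts at [f] and [mu]. *)
have [a /andP[na aI]] := rat_between c1I.
have [|b /andP[nb ba]] := @rat_between R n (ratr a / ratr c1).
  by rewrite ltr_pdivlMr// mulrC.
have [c2 /andP[cc2 c21]] := rat_between cc1.
have [a' /andP[aa' a'I]] := rat_between aI.
have [b' /andP[nb' b'b]] := rat_between nb.
pose l : seq (sort real_signature) := [:: sMe; sLi].
pose m' : term (@ctx _ l) sMe := Var (@ctx _ l) None.
pose f' : term (@ctx _ l) sLi := Var (@ctx _ l) (Some None).
pose lx : seq (sort real_signature) := [:: sOm; sMe; sLi].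
pose xx : term (@ctx _ lx) sOm := Var (@ctx _ lx) None.
pose fx : term (@ctx _ lx) sLi := Var (@ctx _ lx) (Some (Some None)).
pose p (r : {posnum rat}) a b c : formula (@ctx _ l) :=
  Or (Or (Le (rapp Integ (args2 f' (rapp MVar (args1 m')))) a)
         (Ge (rapp MNorm (args1 m')) b))
     (@Ex real_signature _ (@ctx _ l) sOm r (Ge (rapp LEval (args2 fx xx)) c)).
pose e : env N (@ctx _ l) := bind_env (bind_env (empty_env N) f) mu.
have : sat (p 2%:pos a' b' c2) e.
  apply: (@transfer _ _ _ _ l (p 1%:pos a b c1) _ hN); last first.
    do 2 eexists; split; last reflexivity.
      do 2 eexists; split; last reflexivity.
        by exists a' => //; rewrite -(ltr_rat R).
      by exists b' => //; rewrite -(ltr_rat R).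
    do 2 eexists; split; last reflexivity; first by rewrite /= ltr1n.
    by exists c2 => //; rewrite -(ltr_rat R).
  move=> M [d [T [pt [st [fu [ch cM]]]]]] {}e; rewrite /p /=; eval_rop.
  apply: contrapT => /not_orP[/not_orP[/negP h1 /negP h2] h]; move: h1 h2; rewrite -!ltNge => h1 h2.
  have : (rop M Integ (e (Some None)) (rop M MVar (e None)) : R)
      <= ratr c1 * rop M MNorm (e None).
    apply: (classical_Integ_le cM) (ltW c1p) _ => x; rewrite leNgt; apply/negP => cx.
    apply: h; exists x; last by eval_rop; exact: ltW.
    by rewrite /in_ball (pt_dist cM) rmorph1; case: (_ != _).
  apply/negP; rewrite -ltNge (le_lt_trans _ h1)// (@le_trans _ _ (ratr c1 * ratr b))//.
    by rewrite ler_wpM2l// ltW.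
  by move: ba; rewrite ltr_pdivlMr// mulrC => /ltW.
rewrite /p /=; eval_rop => -[[|]|[x _]].
- by rewrite leNgt a'I.
- by rewrite leNgt nb'.
- by eval_rop => cx; exists x; exact: lt_le_trans cx.
Qed.

End RealFrameworks.

(** * Banach pre-integration frameworks *)

Section BanachFrameworksFacts.
Variable R : realType.
Implicit Type N : structure R banach_signature.

Local Notation bapp f := (@App banach_signature _ _ f).

Lemma interp_bop N (f : bsym) (a : forall j : arg (s := banach_signature) (inr f), N (dom j)) :
  @interp R banach_signature N (inr f) a = papply (C := N) (p := bprofile f) (bop N f) a.
Proof. by rewrite /bop (papplyE (C := N)). Qed.

(** The casts are the identity at each concrete sort, so the three instances that follow hold by
    conversion. *)
Lemma interp_oldop N (f : rsym)
    (a : forall j : arg (s := banach_signature) (inl f), N (dom j)) :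
  of_ext (@interp R banach_signature N (inl f) a)
  = papply (C := reduct N) (p := rprofile f) (oldop N f)
      (fun j => @of_ext R real_signature banach_extension (univ N) (@dom real_signature f j) (a j)).
Proof.
rewrite /oldop -interp_rop /= /reduct_interp; congr (of_ext (@interp _ _ N (inl f) _)).
by apply: functional_extensionality_dep => j; rewrite of_extK.
Qed.

Lemma interp_LEval N (a : forall j : arg (s := banach_signature) (inl LEval), N (dom j)) :
  @interp R banach_signature N (inl LEval) a = oldop N LEval (a true) (a false).
Proof. exact: (@interp_oldop N LEval a). Qed.

Lemma interp_Integ N (a : forall j : arg (s := banach_signature) (inl Integ), N (dom j)) :
  @interp R banach_signature N (inl Integ) a = oldop N Integ (a true) (a false).
Proof. exact: (@interp_oldop N Integ a). Qed.

Lemma interp_MVar N (a : forall j : arg (s := banach_signature) (inl MVar), N (dom j)) :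
  @interp R banach_signature N (inl MVar) a = oldop N MVar (a tt).
Proof. exact: (@interp_oldop N MVar a). Qed.

(** From [x - y = (x + a y) - (a + 1) y]. The scalar is kept general because it is a free variable
    of the transferred conditions; the error term vanishes at [a = -1]. *)
Lemma banach_dist_le (V : pmetric R) zero add scale norm :
  @is_banach_space R V zero add scale norm ->
  forall (a : R) x y, mdist x y <= norm (add x (scale a y)) + `|a + 1| * norm y.
Proof.
case=> W [h [_ [_ hD hZ hn hd]]] a x y; rewrite hd !hn hD hZ.
have -> : h x - h y = (h x + a *: h y) - (a + 1) *: h y.
  by rewrite scalerDl scale1r opprD addrA addrK.
by rewrite (le_trans (ler_normB _ _))// normrZ.
Qed.

Lemma banach_norm_le (V : pmetric R) zero add scale norm :
  @is_banach_space R V zero add scale norm ->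
  forall (a : R) x y, norm (add x (scale a y)) <= mdist x y + `|a + 1| * norm y.
Proof.
case=> W [h [_ [_ hD hZ hn hd]]] a x y; rewrite hd !hn hD hZ.
have -> : h x + a *: h y = (h x - h y) + (a + 1) *: h y.
  by rewrite scalerDl scale1r [_ + h y]addrC addrA subrK.
by rewrite (le_trans (ler_normD _ _))// normrZ.
Qed.

Lemma banach_dist (V : pmetric R) zero add scale norm :
  @is_banach_space R V zero add scale norm ->
  forall x y, norm (add x (scale (-1) y)) = mdist x y.
Proof.
by case=> W [h [_ [_ hD hZ hn hd]]] x y; rewrite hd hn hD hZ scaleN1r.
Qed.

Variables (N : structure R banach_signature) (hN : banach_preintegration_reduct N).

Lemma real_framework_reduct : real_preintegration_framework (reduct N).
Proof. by apply: models_reduct hN => M /expansion_reduct. Qed.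

Definition pointwise_dist (F G : N bLb) : N bLi :=
  bop N FAbs (bop N FAdd F (bop N FScale (-1) G)).

Ltac eval_bop := rewrite ?mxE /= /evalR /=;
  do 4 rewrite ?interp_bop ?interp_Integ ?interp_LEval ?interp_MVar /=.

(** The norm inequality for the pairing, applied to [F + a G] within the class and read at [a = -1]
    in [N]. *)
Lemma Pairing_dist (F G : N bLb) (mu : N bMe) :
  mdist (bop N Pairing F mu) (bop N Pairing G mu)
  <= `|oldop N Integ (pointwise_dist F G) (oldop N MVar mu) : R|.
Proof.
pose l : seq (sort banach_signature) := [:: bMe; None; bLb; bLb].
pose m' : term (@ctx _ l) bMe := Var (@ctx _ l) None.
pose a' : term (@ctx _ l) None := Var (@ctx _ l) (Some None).
pose G' : term (@ctx _ l) bLb := Var (@ctx _ l) (Some (Some None)).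
pose F' : term (@ctx _ l) bLb := Var (@ctx _ l) (Some (Some (Some None))).
pose FaG : term (@ctx _ l) bLb :=
  bapp (inr FAdd) (args2 F' (bapp (inr FScale) (args2 a' G'))).
pose PG : term (@ctx _ l) bBa := bapp (inr Pairing) (args2 G' m').
pose PF : term (@ctx _ l) bBa := bapp (inr Pairing) (args2 F' m').
pose t : 'I_4 -> term (@ctx _ l) None := tnth [tuple Dist PF PG;
  bapp (inl Integ) (args2 (bapp (inr FAbs) (args1 FaG)) (bapp (inl MVar) (args1 m')));
  a'; bapp (inr BNorm) (args1 PG)].
pose Phi (v : 'rV[R]_4) : R := v 0 0 - `|v 0 1| - `|v 0 2 + 1| * v 0 3.
pose e : env N (@ctx _ l) :=
  bind_env (bind_env (bind_env (bind_env (empty_env N) F) G) (-1 : N None)) mu.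
have : Phi (\row_i evalR e (t i)) <= 0.
  apply: (@transfer_le _ _ _ _ l _ t Phi hN) => [|M KM {}e].
    by rewrite /Phi; prove_continuous.
  rewrite /Phi; eval_bop; rewrite -addrA -opprD subr_le0.
  apply: le_trans (banach_dist_le (banach_B KM) (e (Some None) : R) _ _) _.
  apply: lerD; last exact: lexx.
  by rewrite -(Pairing_scalel KM) -(Pairing_addl KM); exact: Pairing_norm.
rewrite /Phi; eval_bop.
by rewrite addNr normr0 mul0r subr0 subr_le0.
Qed.

(** The equality is transferred as a two-sided bound with error [|a + 1|] times a norm, which is 0
    at [a = -1]. *)
Lemma LEval_pointwise_dist (F G : N bLb) (x : N bOm) :
  (oldop N LEval (pointwise_dist F G) x : R)
  = mdist (bop N FEval F x) (bop N FEval G x).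
Proof.
pose l : seq (sort banach_signature) := [:: bOm; None; bLb; bLb].
pose x' : term (@ctx _ l) bOm := Var (@ctx _ l) None.
pose a' : term (@ctx _ l) None := Var (@ctx _ l) (Some None).
pose G' : term (@ctx _ l) bLb := Var (@ctx _ l) (Some (Some None)).
pose F' : term (@ctx _ l) bLb := Var (@ctx _ l) (Some (Some (Some None))).
pose FaG : term (@ctx _ l) bLb :=
  bapp (inr FAdd) (args2 F' (bapp (inr FScale) (args2 a' G'))).
pose Fx : term (@ctx _ l) bBa := bapp (inr FEval) (args2 F' x').
pose Gx : term (@ctx _ l) bBa := bapp (inr FEval) (args2 G' x').
pose t : 'I_4 -> term (@ctx _ l) None := tnth [tuple Dist Fx Gx;
  bapp (inl LEval) (args2 (bapp (inr FAbs) (args1 FaG)) x');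
  a'; bapp (inr BNorm) (args1 Gx)].
pose Phi (v : 'rV[R]_4) : R := `|v 0 0 - v 0 1| - `|v 0 2 + 1| * v 0 3.
pose e : env N (@ctx _ l) :=
  bind_env (bind_env (bind_env (bind_env (empty_env N) F) G) (-1 : N None)) x.
have : Phi (\row_i evalR e (t i)) <= 0.
  apply: (@transfer_le _ _ _ _ l _ t Phi hN) => [|M KM {}e].
    by rewrite /Phi; prove_continuous.
  rewrite /Phi; eval_bop; rewrite subr_le0 (FAbs_eval KM) (FEval_add KM) (FEval_scale KM).
  have dist_le (p q n : R) : p <= q + n -> q <= p + n -> `|q - p| <= n.
    by move=> ? ?; rewrite ler_norml; lra.
  exact: (dist_le _ _ _ (banach_norm_le (banach_B KM) _ _ _)
    (banach_dist_le (banach_B KM) _ _ _)).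
rewrite /Phi; eval_bop.
by rewrite addNr normr0 mul0r subr0 normr_le0 subr_eq0 => /eqP.
Qed.

(** In the class, the norm of [F - G] is the supremum of its pointwise norms. *)
Lemma FEval_dist (F G : N bLb) (x : N bOm) :
  mdist (bop N FEval F x) (bop N FEval G x) <= mdist F G.
Proof.
pose l : seq (sort banach_signature) := [:: bOm; bLb; bLb].
pose x' : term (@ctx _ l) bOm := Var (@ctx _ l) None.
pose G' : term (@ctx _ l) bLb := Var (@ctx _ l) (Some None).
pose F' : term (@ctx _ l) bLb := Var (@ctx _ l) (Some (Some None)).
pose Fx : term (@ctx _ l) bBa := bapp (inr FEval) (args2 F' x').
pose Gx : term (@ctx _ l) bBa := bapp (inr FEval) (args2 G' x').
pose t : 'I_2 -> term (@ctx _ l) None := tnth [tuple Dist Fx Gx; Dist F' G'].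
pose Phi (v : 'rV[R]_2) : R := v 0 0 - v 0 1.
pose e : env N (@ctx _ l) := bind_env (bind_env (bind_env (empty_env N) F) G) x.
have : Phi (\row_i evalR e (t i)) <= 0.
  apply: (@transfer_le _ _ _ _ l _ t Phi hN) => [|M KM {}e].
    by rewrite /Phi; prove_continuous.
  rewrite /Phi; eval_bop; rewrite subr_le0.
  rewrite -(banach_dist (banach_B KM)) -(banach_dist (banach_F KM)).
  rewrite -(FEval_scale KM) -(FEval_add KM) -lee_fin (FEval_norm KM).
  by apply: ereal_sup_ubound; exists (e None).
by rewrite /Phi; eval_bop; rewrite subr_le0.
Qed.

End BanachFrameworksFacts.

(** * Integrals of sequences *)

Section MonotoneIntegral.
Variables (R : realType) (N : structure R real_signature).
Hypothesis hN : real_preintegration_framework N.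
Variable mu : N sMe.

Let ev (f : N sLi) (x : N sOm) : R := rop N LEval f x.
Let integ (f : N sLi) : R := rop N Integ f (rop N MVar mu).

(** Otherwise [f - g] has positive integral, hence a positive value by [Integ_MVar_gt] with
    [c = 0]. *)
Lemma Integ_MVar_le (f g : N sLi) :
  (forall x, (rop N LEval f x : R) <= rop N LEval g x) ->
  (rop N Integ f (rop N MVar mu) : R) <= rop N Integ g (rop N MVar mu).
Proof.
move=> fg; rewrite leNgt; apply/negP => gf.
have [|x] := @Integ_MVar_gt R N hN (rop N LAdd f (rop N LScale (-1) g)) mu 0 (lexx _).
  by rewrite mul0r (Integ_lin hN) mulN1r subr_gt0.
by rewrite (LEval_lin hN) mulN1r subr_gt0 ltNge fg.
Qed.

(** The sums [max + min] and [f + g] have the same values; monotonicity in both directions gives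
    equal integrals without identifying the two elements. *)
Lemma Integ_max_min (f g : N sLi) :
  integ (rop N LMax f g) + integ (rop N LMin f g) = integ f + integ g.
Proof.
have h x : ev (rop N LAdd (rop N LMax f g) (rop N LScale 1 (rop N LMin f g))) x
    = ev (rop N LAdd f (rop N LScale 1 g)) x.
  rewrite /ev !(LEval_lin hN) (LEval_max hN) (LEval_min hN) !mul1r.
  by rewrite addr_max_min.
have := @Integ_MVar_le (rop N LAdd (rop N LMax f g) (rop N LScale 1 (rop N LMin f g)))
  (rop N LAdd f (rop N LScale 1 g)).
have := @Integ_MVar_le (rop N LAdd f (rop N LScale 1 g))
  (rop N LAdd (rop N LMax f g) (rop N LScale 1 (rop N LMin f g))).
rewrite !(Integ_lin hN) !mul1r => h1 h2; apply/eqP; rewrite eq_le; apply/andP; split.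
  by apply: h2 => x; rewrite -/(ev _ x) h.
by apply: h1 => x; rewrite -!/(ev _ x) h.
Qed.

Section Sequences.
Variable f : nat -> N sLi.

Fixpoint running_max (l m : nat) : N sLi :=
  if m is m'.+1 then rop N LMax (running_max l m') (f (l + m)) else f l.

Fixpoint running_min (k : nat) : N sLi :=
  if k is k'.+1 then rop N LMin (running_min k') (f k) else f 0.

Lemma le_running_max l m n x : (l <= n <= l + m)%N -> ev (f n) x <= ev (running_max l m) x.
Proof.
elim: m => [|m IH] /=; first by rewrite addn0 -eqn_leq => /eqP ->.
rewrite /ev (LEval_max hN) le_max => /andP[ln]; rewrite leq_eqVlt => /predU1P[->|].
  by rewrite lexx orbT.
by rewrite addnS ltnS => nm; rewrite IH ?ln.
Qed.

(** Attainment at an index is what later turns a lower bound on [g l] at a point into one on some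
    [f n]. *)
Lemma running_max_ex l m x : exists2 n,
  (l <= n <= l + m)%N & ev (running_max l m) x = ev (f n) x.
Proof.
elim: m => [|m [n /andP[ln nm] h]] /=; first by exists l; rewrite ?addn0 ?leqnn.
rewrite /ev (LEval_max hN); case: leP => _.
  by exists (l + m.+1)%N; rewrite ?leqnn ?leq_addr.
by exists n => //; rewrite ln addnS (leq_trans nm).
Qed.

Lemma running_min_le k l x : (l <= k)%N -> ev (running_min k) x <= ev (f l) x.
Proof.
elim: k => [|k IH] /=; first by rewrite leqn0 => /eqP ->.
rewrite /ev (LEval_min hN) ge_min leq_eqVlt => /predU1P[->|].
  by rewrite lexx orbT.
by rewrite ltnS => lk; rewrite IH.
Qed.

End Sequences.

(* A substitute for Fatou's lemma: [g l] is a maximum of finitely many terms of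
   the tail [f n], [n >= l], whose integral is within [(s - s') / 2 ^ (l + 1)] of
   the supremum of the integrals of such maxima. As [g l.+1] is also such a
   maximum for the tail from [l], replacing [g l] by its minimum with [g l.+1]
   costs little, by [Integ_max_min]. *)
Lemma running_min_integral (f : nat -> N sLi) (B s s' : R) :
  (forall n x, (rop N LEval (f n) x : R) <= B) ->
  (forall n, s <= (rop N Integ (f n) (rop N MVar mu) : R)) -> s' < s ->
  exists g : nat -> N sLi,
    (forall l x, exists2 n, (l <= n)%N & rop N LEval (g l) x = rop N LEval (f n) x) /\
    (forall k, s' <= (rop N Integ (running_min g k) (rop N MVar mu) : R)).
Proof.
move=> fB sf ss'.
pose S l := range (fun m => integ (running_max f l m)).
(* The suprema are finite because the [f n] are uniformly bounded; [|B|] is used because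
   [Integ_MVar_gt] asks for a nonnegative constant. *)
have S_ub l m : integ (running_max f l m) <= `|B| * rop N MNorm mu.
  rewrite leNgt; apply/negP => /(Integ_MVar_gt hN (normr_ge0 B))[x].
  have [n _] := running_max_ex f l m x; rewrite /ev => ->.
  by rewrite ltNge (le_trans (fB n x))// ler_norm.
have S_sup l : has_sup (S l).
  split; first by exists (integ (running_max f l 0)), 0.
  by exists (`|B| * rop N MNorm mu) => _ [m _ <-].
have le_sup l m : integ (running_max f l m) <= sup (S l).
  by apply: sup_upper_bound => //; exists m.
have adh l : exists m, sup (S l) - (s - s') / 2 ^+ l.+1 < integ (running_max f l m).
  have [|_ [m _ <-] h] := @sup_adherent _ (S l) ((s - s') / 2 ^+ l.+1) _ (S_sup l).
    by rewrite divr_gt0// ?subr_gt0// exprn_gt0.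
  by exists m.
have {adh}[m hm] := choice adh.
pose g l := running_max f l (m l).
exists g; split => [l x|].
  by have [n /andP[ln _] h] := running_max_ex f l (m l) x; exists n.
(* The losses [(s - s') / 2 ^ (l + 1)] for [l <= k] add up to [(s - s') (1 - 2 ^ - (k + 1))].
   Comparing with [sup (S k)] rather than [s] lets the induction work: in [Integ_max_min] the
   integral of the maximum is at most [sup (S k)], which cancels and leaves [sup (S k.+1)]. *)
have main k : sup (S k) - (s - s') * (1 - (2 ^+ k.+1)^-1) <= integ (running_min g k).
  elim: k => [|k IH] /=.
    rewrite (le_trans _ (ltW (hm 0)))// expr1 lerD2l lerN2.
    by rewrite [1 - _](_ : _ = 2^-1)//; field.
  (* [g k.+1] uses the indices up to [k.+1 + m k.+1], that is [k + (m k.+1).+1]; hence the successor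
     in the length of the tail maximum from [k]. *)
  have max_le : integ (rop N LMax (running_min g k) (g k.+1)) <= sup (S k).
    apply: le_trans (le_sup k (maxn (m k) (m k.+1).+1)); apply: Integ_MVar_le => x.
    rewrite (LEval_max hN) ge_max; apply/andP; split.
      apply: le_trans (running_min_le g x (leqnn k)) _.
      have [n /andP[kn nm] ->] := running_max_ex f k (m k) x.
      by apply: le_running_max; rewrite kn (leq_trans nm)// leq_add2l leq_maxl.
    have [n /andP[kn nm]] := running_max_ex f k.+1 (m k.+1) x; rewrite /ev /g => ->.
    apply: le_running_max; rewrite ltnW//= (leq_trans nm)// addSnnS leq_add2l.
    exact: leq_maxr.
  have := Integ_max_min (running_min g k) (g k.+1); have := hm k.+1; rewrite -/(g k.+1).
  have -> : (s - s') / 2 ^+ k.+2 = (s - s') / 2 ^+ k.+1 / 2.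
    by rewrite [2 ^+ k.+2]exprSr; field.
  rewrite [2 ^+ k.+2]exprSr invfM; move: IH max_le.
  by set i := (2 ^+ k.+1)^-1; lra.
move=> k; apply: le_trans (main k).
have fk : s <= sup (S k) := le_trans (sf k) (le_sup k 0).
have k0 : 0 < (2 ^+ k.+1)^-1 :> R by rewrite invr_gt0 exprn_gt0.
have : 0 <= (s - s') * (2 ^+ k.+1)^-1 by rewrite mulr_ge0 ?subr_ge0// ltW.
by rewrite mulrBr mulr1; lra.
Qed.

End MonotoneIntegral.

(** * Saturation and oscillation *)

Section SaturatedPoints.
Variables (R : realType) (E : extension banach_signature) (M : structure R (extend E)).

(** Saturation for the conditions [g_l(x) >= q], with the countably many [g_l] as parameters.
    Finitely many approximations involve finitely many [l], and a point good up to their maximum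
    satisfies them. *)
Lemma saturated_common_point (g : nat -> reduct M bLi) (q : rat) : saturated M ->
  (forall x y : reduct M bOm, mdist x y <= 1) ->
  (forall k, exists x : reduct M bOm,
     forall l, (l <= k)%N -> ratr q <= (oldop (reduct M) LEval (g l) x : R)) ->
  exists x : reduct M bOm,
    forall l, ratr q <= (oldop (reduct M) LEval (g l) x : R).
Proof.
move=> satM ptM hg.
pose sL : sort (extend E) := Some (inl (inl LinfR)).
pose sO : sort (extend E) := Some (inl (inl Points)).
pose a l : {s : sort (extend E) & M s} := existT (fun s => M s) sL (g l).
pose A := range a.
have aA l : A (a l) by exists l.
have cA : countable A by exact: card_image_le.
pose sg (i : 'I_1) := sO.
pose psi l r : formula (param_context (A := A) sg) :=
  Ge (@App (extend E) _ (param_context (A := A) sg) (inl (inl LEval))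
    (args2 (Var (param_context (A := A) sg) (inr (exist _ (a l) (aA l))))
           (Var (param_context (A := A) sg) (inl ord0)))) r.
have psiE l r (b : env M sg) :
    sat (psi l r) (param_env b) <-> ratr r <= (oldop (reduct M) LEval (g l) (b ord0) : R).
  pose c (j : bool) : reduct M (@dom banach_signature (inl LEval) j) :=
    match j with true => g l | false => b ord0 end.
  suff /= -> : evalR (param_env b) (@App (extend E) _ (param_context (A := A) sg)
      (inl (inl LEval)) (args2 (Var (param_context (A := A) sg) (inr (exist _ (a l) (aA l))))
           (Var (param_context (A := A) sg) (inl ord0)))) = oldop (reduct M) LEval (g l) (b ord0).
    by [].
  rewrite -(interp_LEval c) /evalR /= /reduct_interp /=.
  congr (@interp R (extend E) M (inl (inl LEval)) _).
  by apply: functional_extensionality_dep; case.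
have [Del finDel hDel|b _ hb] :=
    satM A cA 1 sg (fun=> 1) (range (fun l => psi l q)); last first.
  by exists (b ord0) => l; apply: (proj1 (psiE l q b)); apply: hb; exists l.
(* [idx] recovers the index behind a formula of [Del]; elsewhere it is 0 by default. *)
have /choice[idx hidx] p : exists l, Del p -> exists2 r, r < q & p = psi l r.
  have [/hDel[_ [l _ <-] [r rq ->]]|np] := pselect (Del p); last by exists 0.
  by exists l => _; exists r.
have /finite_seqP[s hs] := finite_image idx finDel.
have [x hx] := hg (\max_(l <- s) l)%N.
exists (fun=> x) => [i|p Dp]; first exact: ptM.
have [r rq ->] := hidx p Dp; apply: (proj2 (psiE (idx p) r (fun=> x))).
apply: (@le_trans _ _ (ratr q)); first by rewrite ler_rat ltW.
apply: hx; apply: leq_bigmax_seq => //.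
have : [set` s] (idx p) by rewrite -hs; exists p.
by [].
Qed.

End SaturatedPoints.

(** Each [u n.+1] is above [u n] and the next element of an enumeration, so [u m] dominates [i] from
    the number of [i] on. *)
Lemma cofinal_sequence (D : Type) (le : D -> D -> Prop) :
  directed le -> countable [set: D] ->
  exists u : nat -> D, forall i, exists n, forall m, (n <= m)%N -> le i (u m).
Proof.
move=> dirD /(@pcard_leP D nat)/unsquash h.
have hinj (d d' : D) : h d = h d' -> d = d' by apply: inj; rewrite inE.
have [d0] := directed_inhabited dirD.
(* [e] inverts the injection [h], with the arbitrary value [d0] off its range. *)
have /choice[e he] n : exists d, forall d', h d' = n -> d' = d.
  have [[d <-]|nd] := pselect (exists d, h d = n); first by exists d => d' /hinj.
  by exists d0 => d' hd'; case: nd; exists d'.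
have /choice[ub hub] (p : D * D) : exists k, le p.1 k /\ le p.2 k.
  by have [k] := directed_ub dirD p.1 p.2; exists k.
pose u := fix u n := if n is n'.+1 then ub (u n', e n) else e 0.
have uS n : le (u n) (u n.+1) by have [] := hub (u n, e n.+1).
have ue n : le (e n) (u n).
  by case: n => [|n]; [exact: directed_refl|have [] := hub (u n, e n.+1)].
exists u => i; exists (h i) => m; elim: m => [|m IH].
  by rewrite leqn0 => /eqP hi; rewrite (he _ _ hi); exact: ue.
rewrite leq_eqVlt => /predU1P[hi|]; first by rewrite (he _ _ hi); exact: ue.
by rewrite ltnS => /IH h1; exact: directed_trans h1 (uS m).
Qed.

(** * Oscillation of nets *)

Section Oscillation.
Variables (R : realType) (D : Type) (le : D -> D -> Prop) (dirD : directed le).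
Variables (V : metricType R) (a : D -> V).

Lemma le_spread i j k : le i j -> le i k -> ((mdist (a j) (a k))%:E <= spread le a i)%E.
Proof. by move=> ij ik; apply: ereal_sup_ubound; exists (j, k). Qed.

Lemma osc_ge0 : (0 <= osc le a)%E.
Proof.
apply: le_ereal_inf_tmp => _ [i _ <-].
by apply: le_trans (le_spread (directed_refl dirD i) (directed_refl dirD i)); rewrite mdistxx.
Qed.

Lemma osc_le (B : R) : (forall j k, mdist (a j) (a k) <= B) -> (osc le a <= B%:E)%E.
Proof.
move=> aB; have [i] := directed_inhabited dirD.
apply: (@le_trans _ _ (spread le a i)); first by apply: ereal_inf_lbound; exists i.
by apply: ge_ereal_sup => _ [p _ <-]; rewrite lee_fin.
Qed.

Lemma osc_gt (s : R) i : (s%:E < osc le a)%E ->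
  exists p : D * D, [/\ le i p.1, le i p.2 & s < mdist (a p.1) (a p.2)].
Proof.
move=> sa; have : (s%:E < spread le a i)%E.
  by apply: lt_le_trans sa _; apply: ereal_inf_lbound; exists i.
by move=> /ereal_sup_gt[_ [p [ij ik] <-]]; rewrite lte_fin => h; exists p.
Qed.

Lemma osc_lt (s : R) : (osc le a < s%:E)%E ->
  exists i, forall j k, le i j -> le i k -> mdist (a j) (a k) < s.
Proof.
move=> /ereal_inf_lt[_ [i _ <-]] h; exists i => j k ij ik.
by rewrite -lte_fin (le_lt_trans (le_spread ij ik)).
Qed.

End Oscillation.

(** * The oscillation inequality for the pairing *)

Section Integration.
Variables (R : realType) (D : Type) (le : D -> D -> Prop).
Hypotheses (dirD : directed le) (cntD : countable [set: D]).
Variables (E : extension banach_signature) (M : structure R (extend E)).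
Hypothesis hM : banach_integration_framework M.
Variable phi : D -> reduct M bLb.
Hypothesis bphi : bounded_net (anchor (reduct M bLb)) phi.

Lemma phi_dist_bounded : exists B : R, forall j k, mdist (phi j) (phi k) <= B.
Proof.
have [C hC] := bphi; exists (C + C) => j k.
apply: le_trans (metric_triangle _ (anchor (reduct M bLb)) _) _.
by rewrite lerD// metric_sym.
Qed.

(** Zero enters as [f - f], whose values and integral vanish by linearity; monotonicity compares it
    with [f]. *)
Lemma Integ_pointwise_dist_ge0 (F G : reduct M bLb) (mu : reduct M bMe) :
  0 <= (oldop (reduct M) Integ (pointwise_dist F G) (oldop (reduct M) MVar mu) : R).
Proof.
have [hN _] := hM; have hr := real_framework_reduct hN.
set f := pointwise_dist F G.
have := @Integ_MVar_le R (reduct (reduct M)) hr mu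
  (oldop (reduct M) LAdd f (oldop (reduct M) LScale (-1) f)) f.
rewrite (Integ_lin hr) mulN1r subrr; apply => x.
rewrite (LEval_lin hr) mulN1r subrr.
by have := LEval_pointwise_dist hN F G x; rewrite /oldop /f => ->; exact: mdist_ge0.
Qed.

Lemma oscillating_point (mu : reduct M bMe) (q : rat) (s : R) : 0 <= q ->
  ratr q * (oldop (reduct M) MNorm mu : R) < s ->
  (s%:E < osc le (fun j => bop (reduct M) Pairing (phi j) mu))%E ->
  exists x : reduct M bOm, forall i, exists j k, [/\ le i j, le i k &
    ratr q <= mdist (bop (reduct M) FEval (phi j) x) (bop (reduct M) FEval (phi k) x)].
Proof.
move=> q0 qs sosc; have [hN satM] := hM; have hr := real_framework_reduct hN.
have [u hu] := cofinal_sequence dirD cntD.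
have /choice[p hp] n := osc_gt (u n) sosc.
pose f n := pointwise_dist (phi (p n).1) (phi (p n).2).
have [B hB] := phi_dist_bounded.
have fB n x : (oldop (reduct M) LEval (f n) x : R) <= B.
  by rewrite LEval_pointwise_dist// (le_trans (FEval_dist hN _ _ _)).
have fs n : s <= (oldop (reduct M) Integ (f n) (oldop (reduct M) MVar mu) : R).
  have [_ _ /ltW h] := hp n; apply: le_trans h _.
  rewrite (le_trans (Pairing_dist hN _ _ _))// ger0_norm//.
  exact: Integ_pointwise_dist_ge0.
(* Finite minima of the [g l] will keep integral at least [s'], and hence exceed [q] somewhere. *)
have [s' /andP[qs' s's]] : exists s', (ratr q * (oldop (reduct M) MNorm mu : R) < s') && (s' < s).
  by exists ((ratr q * (oldop (reduct M) MNorm mu : R) + s) / 2); rewrite !midf_lt.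
have [g [gf gs]] := running_min_integral hr fB fs s's.
have [x y|k|x hx] := @saturated_common_point R E M g q satM.
- exact: (points_bounded hr).
- have [|x hx] := Integ_MVar_gt hr (c := ratr q) _ (lt_le_trans qs' (gs k)).
    by rewrite ler0q.
  by exists x => l lk; apply: le_trans (ltW hx) _; exact: running_min_le.
(* At [x], [g n0] equals some [f n] with [n >= n0]; the pair of indices behind [f n] lies beyond
   [u n], hence beyond [i]. *)
exists x => i; have [n0 hn0] := hu i; have [n nn0 gfn] := gf n0 x.
have [un1 un2 _] := hp n; exists (p n).1, (p n).2; split.
- exact: directed_trans (hn0 n nn0) un1.
- exact: directed_trans (hn0 n nn0) un2.
- by rewrite -LEval_pointwise_dist// /oldop -/(f n) -gfn; exact: hx.
Qed.

Lemma osc_Pairing_le (mu : reduct M bMe) :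
  (osc le (fun j => bop (reduct M) Pairing (phi j) mu)
   <= (oldop (reduct M) MNorm mu)%:E
      * ereal_sup (range (fun x : reduct M bOm =>
          osc le (fun j => bop (reduct M) FEval (phi j) x))))%E.
Proof.
have [hN _] := hM; have hr := real_framework_reduct hN.
have [B hB] := phi_dist_bounded.
set r := ereal_sup _.
have osc_r x : (osc le (fun j => bop (reduct M) FEval (phi j) x) <= r)%E.
  by apply: ereal_sup_ubound; exists x.
have r0 : (0 <= r)%E := le_trans (osc_ge0 dirD _) (osc_r (anchor (reduct M bOm))).
(* A bound uniform in [x] makes [r] finite, so that the product becomes one of real numbers. *)
have rB : (r <= B%:E)%E.
  apply: ge_ereal_sup => _ [x _ <-]; apply: osc_le => // j k.
  exact: le_trans (FEval_dist hN _ _ _) (hB j k).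
have rfin : r \is a fin_num by rewrite ge0_fin_numE// (le_lt_trans rB)// ltry.
move: (fineK rfin) osc_r r0; set r1 : R := fine r => <- osc_r; rewrite lee_fin => r0.
set n : R := oldop (reduct M) MNorm mu.
have n0 : 0 <= n := MNorm_ge0 hr mu.
rewrite -EFinM; apply/lee_addgt0Pr => e e0; rewrite -EFinD leNgt; apply/negP => sosc.
(* The upper end is chosen so that [n * q < n * r1 + e], including when [n = 0]. *)
have [|q /andP[rq qe]] := @rat_between R r1 (r1 + e / (n + 1)).
  by rewrite ltrDl divr_gt0// ltr_wpDl.
have [||x hx] := @oscillating_point mu q (n * r1 + e) _ _ sosc.
- by rewrite -(ler0q R) (le_trans r0)// ltW.
- rewrite mulrC -/n (@le_lt_trans _ _ (n * (r1 + e / (n + 1))))//.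
    by rewrite ler_wpM2l// ltW.
  rewrite mulrDr ltrD2l mulrA ltr_pdivrMr ?ltr_wpDl// mulrDr mulr1 mulrC ltrDl//.
(* As the oscillation at [x] is at most [r1 < q], distances beyond some [i] are below [q], against
   the choice of [x]. *)
have [|i hi] := @osc_lt R D le _ (fun j => bop (reduct M) FEval (phi j) x) (ratr q).
  by rewrite (le_lt_trans (osc_r x))// lte_fin.
by have [j [k [ij ik]]] := hx i; rewrite leNgt hi.
Qed.

End Integration.

Theorem theorem5 (R : realType)
  (D : Type) (le : D -> D -> Prop) (dirD : directed le) (cntD : countable [set: D])
  (E : extension banach_signature) (M : structure R (extend E))
  (hM : banach_integration_framework M)
  (phi : D -> reduct M bLb) (bphi : bounded_net (anchor (reduct M bLb)) phi) :
  (forall mu : reduct M bMe,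
     (osc le (fun j => bop (reduct M) Pairing (phi j) mu)
      <= (oldop (reduct M) MNorm mu)%:E
         * ereal_sup (range (fun x : reduct M bOm =>
             osc le (fun j => bop (reduct M) FEval (phi j) x))))%E)
  /\
  ((forall x : reduct M bOm,
      convergent_net le (fun j => bop (reduct M) FEval (phi j) x)) ->
   forall mu : reduct M bMe,
     convergent_net le (fun j => bop (reduct M) Pairing (phi j) mu)).
Proof.
split=> [mu|cphi mu]; first exact: osc_Pairing_le.
apply/eqP; rewrite /convergent_net eq_le osc_ge0// andbT.
apply: le_trans (osc_Pairing_le dirD cntD hM bphi mu) _.
(* The set of oscillations is exactly the singleton of 0; the anchor of Omega shows that it is
   nonempty. *)
rewrite [X in ereal_sup X](_ : _ = [set 0%E]) ?ereal_sup1 ?mule0//.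
apply/seteqP; split=> [_ [x _ <-]|_ ->]; first exact: cphi.
by exists (anchor (reduct M bOm)) => //; exact: cphi.
Qed.
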